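(* There is an algorithm that, given an undirected graph $G$ with $n$ nodes and $m$ edges, lists all $4$-cycles of $G$ in time $O\big(\min(n^2+t,\ (m^{4/3}+t)\cdot \log^2 n)\big)$, where $t$ is the number of $4$-cycles in $G$.
   Context: Graphs are simple, unweighted and undirected, with $n$ nodes and $m$ edges. A $4$-cycle is a cycle on four distinct nodes. ''Listing'' means outputting every $4$-cycle of the graph. Running time is measured in the standard RAM model with the graph given by adjacency lists. *)

(* Defs.v *)
From Stdlib Require Import Reals.
From mathcomp Require Import all_boot.
Set Implicit Arguments. Unset Strict Implicit. Unset Printing Implicit Defensive.

Definition nbrs (adj : seq (seq nat)) (u : nat) : seq nat := nth [::] adj u.

Definition wf_adj (adj : seq (seq nat)) : Prop :=
  forall u, u < size adj ->
    [/\ uniq (nbrs adj u),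
        all (fun v => v < size adj) (nbrs adj u),
        u \notin nbrs adj u &
        forall v, v \in nbrs adj u -> u \in nbrs adj v].

Definition n_of (adj : seq (seq nat)) : nat := size adj.
Definition m_of (adj : seq (seq nat)) : nat := (sumn (map size adj)) %/ 2.

Definition gedge (adj : seq (seq nat)) : rel 'I_(size adj) :=
  fun u v => nat_of_ord v \in nbrs adj u.

Definition is_c4 n (E : rel 'I_n) (a b c d : 'I_n) : bool :=
  [&& uniq [:: a; b; c; d], E a b, E b c, E c d & E d a].

Definition c4_edges n (a b c d : 'I_n) : {set {set 'I_n}} :=
  [set [set a; b]; [set b; c]; [set c; d]; [set d; a]].

Definition C4 n (E : rel 'I_n) : {set {set {set 'I_n}}} :=
  [set S | [exists a, exists b, exists c, exists d,
              is_c4 E a b c d && (S == c4_edges a b c d)]].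

Definition quad n := ('I_n * 'I_n * 'I_n * 'I_n)%type.
Definition q_edges n (q : quad n) := c4_edges q.1.1.1 q.1.1.2 q.1.2 q.2.
Definition q_ok n (E : rel 'I_n) (q : quad n) := is_c4 E q.1.1.1 q.1.1.2 q.1.2 q.2.
Definition q_words n (q : quad n) : seq nat :=
  [:: nat_of_ord q.1.1.1; nat_of_ord q.1.1.2; nat_of_ord q.1.2; nat_of_ord q.2].

Definition lists_all_C4 n (E : rel 'I_n) (out : seq nat) : Prop :=
  exists qs : seq (quad n),
    [/\ out = flatten (map (@q_words n) qs),
        all (q_ok E) qs,
        uniq (map (@q_edges n) qs) &
        forall S, (S \in C4 E) <-> (S \in map (@q_edges n) qs)].

(* Word RAM.  Registers (directly addressed by program constants) and  *)
(* memory (indirectly addressed), unit-cost operations on words taken  *)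
(* modulo a word modulus M (M = N^(k+1), N the input size: O(log N)-bit *)
(* words).  Output is an append-only stream of words.                  *)

Inductive instr : Type :=
| IConst of nat & nat
| IAdd   of nat & nat & nat
| ISub   of nat & nat & nat    (* r := a - b (truncated at 0) *)
| IMul   of nat & nat & nat
| IDiv   of nat & nat & nat    (* r := a / b (0 if b = 0) *)
| ILoad  of nat & nat
| IStore of nat & nat
| IJz    of nat & nat
| IJmp   of nat
| IOut   of nat
| IHalt.

Record state : Type := State {
  pc : nat; reg : nat -> nat; mem : nat -> nat; outp : seq nat }.

Definition upd (f : nat -> nat) (x y : nat) : nat -> nat :=
  fun z => if z == x then y else f z.

(* one step; None when the machine has halted (Halt or pc out of program) *)
Definition step (M : nat) (P : seq instr) (s : state) : option state :=
  let: State p r mm o := s in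
  match nth IHalt P p with
  | IConst x c => Some (State p.+1 (upd r x (c %% M)) mm o)
  | IAdd x a b => Some (State p.+1 (upd r x ((r a + r b) %% M)) mm o)
  | ISub x a b => Some (State p.+1 (upd r x (r a - r b)) mm o)
  | IMul x a b => Some (State p.+1 (upd r x ((r a * r b) %% M)) mm o)
  | IDiv x a b => Some (State p.+1 (upd r x (r a %/ r b)) mm o)
  | ILoad x a => Some (State p.+1 (upd r x (mm (r a))) mm o)
  | IStore a b => Some (State p.+1 r (upd mm (r a) (r b)) o)
  | IJz a l => Some (State (if r a == 0 then l else p.+1) r mm o)
  | IJmp l => Some (State l r mm o)
  | IOut a => Some (State p.+1 r mm (rcons o (r a)))
  | IHalt => None
  end.

Fixpoint steps (M : nat) (P : seq instr) (k : nat) (s : state) : option state :=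
  match k with
  | 0 => Some s
  | k'.+1 => match step M P s with
             | Some s' => steps M P k' s'
             | None => None
             end
  end.

Definition halts_in (M : nat) (P : seq instr) (s0 : state) (k : nat) (out : seq nat) : Prop :=
  exists s, steps M P k s0 = Some s /\ step M P s = None /\ outp s = out.

(* Input encoding of the adjacency lists in memory (CSR layout):
   mem[0] = n; mem[1+i] (0 <= i <= n) = start address of the list of node i
   (mem[1+n] = end of the last list); the lists follow, starting at n+2. *)
Definition input_words (adj : seq (seq nat)) : seq nat :=
  size adj :: [seq (size adj).+2 + sumn (map size (take i adj)) | i <- iota 0 (size adj).+1]
           ++ flatten adj.

Definition init_state (adj : seq (seq nat)) : state :=
  State 0 (fun _ => 0) (fun x => nth 0 (input_words adj) x) [::].

Definition word_mod (k : nat) (adj : seq (seq nat)) : nat :=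
  (size adj + sumn (map size adj) + 3) ^ k.+1.

Definition c4_bound (n m t : nat) : R :=
  Rmin (INR (n ^ 2 + t))
       (Rmult (Rplus (Rpower (INR m) (Rdiv 4 3)) (INR t)) (pow (ln (INR n)) 2)).

(* Main.v *)
Require Import Defs.
From Stdlib Require Import Reals Lra.
From mathcomp Require Import all_boot zify.
Set Implicit Arguments. Unset Strict Implicit. Unset Printing Implicit Defensive.

(* Order the vertices by degree, ties being broken by the name.  For every
   2-path b - z - d whose endpoint b is above both z and d, the program outputs
   the 4-cycle b z d w for every w already stored in the list of (b, d), and
   then appends z to this list.  A 4-cycle is thus output exactly once, from its
   top vertex b, and the time is O(1 + m + W + t) with
   W = sum_z deg z * #{b ~ z, b above z}.

   Both terms of the minimum come from the same bound on W.  By Cauchy-Schwarz,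
   for a set U of N vertices, Q = sum_(z in U) deg_U(z)^2 satisfies
   Q^2 <= N^2 (8 t + 2 Q), hence Q = O(N^2 + N sqrt t).  Taking for U all the
   vertices gives W <= Q = O(n^2 + t).  For the other term, W is at most
   2 sum_i 2^i e_i, where e_i is the degree sum of the subgraph induced by the
   N_i <= 2m / 2^i vertices of degree at least 2^i, and e_i^2 <= N_i Q_i yields
   2^i e_i = O(m^(4/3) + m t^(1/4)) = O(m^(4/3) + t) when 2^i >= m^(1/3); when
   2^i <= m^(1/3) it is at most 2 m^(4/3).  There are O(log n) values of i. *)

(** * Supersaturation of 4-cycles *)

(** Cauchy-Schwarz against the constant 1: [2 f(i) f(j) <= f(i)^2 + f(j)^2], summed over all
    pairs. *)
Lemma sum_sqr_le (I : finType) (A : pred I) (f : I -> nat) :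
  (\sum_(i in A) f i) ^ 2 <= #|A| * \sum_(i in A) f i ^ 2.
Proof.
rewrite -(leq_pmul2l (isT : 0 < 2)) -mulnn big_distrlr /=.
have -> : 2 * (#|A| * \sum_(i in A) f i ^ 2) =
          \sum_(i in A) \sum_(j in A) (f i ^ 2 + f j ^ 2).
  under [RHS]eq_bigr do rewrite big_split /= sum_nat_const.
  by rewrite big_split /= -big_distrr /= sum_nat_const; lia.
rewrite big_distrr /=; apply: leq_sum => i _.
by rewrite big_distrr /=; apply: leq_sum => j _; exact: nat_Cauchy.
Qed.

Section Supersaturation.
Variables (T : finType) (e : rel T).
Hypotheses (e_sym : symmetric e) (e_irr : irreflexive e).

(** On ordinals this is convertible with [is_c4]; [numc4q] thus counts every 4-cycle once per
    labelling. *)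
Definition c4q (a b c d : T) : bool :=
  [&& uniq [:: a; b; c; d], e a b, e b c, e c d & e d a].

Definition numc4q := \sum_a \sum_b \sum_c \sum_d c4q a b c d.

Definition degin (U : {set T}) z := \sum_(b in U) e z b.
Definition sqdeg (U : {set T}) := \sum_(z in U) degin U z ^ 2.

Lemma leq_sum_setT (A : {set T}) (f : T -> nat) :
  \sum_(x in A) f x <= \sum_x f x.
Proof. by rewrite [leqRHS](bigID (mem A)) /= leq_addr. Qed.

(** Two 2-walks from [x] to [y], through [z] and through [w], close up into a 4-cycle unless [x = y]
    or [z = w]. The last two terms pay for these degenerate cases. *)
Lemma cod_split x z y w :
  (e x z * e z y) * (e x w * e w y) <=
  c4q x z y w + ((x == y) * (e x z * e x w) + (z == w) * (e x z * e z y)).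
Proof.
case: (x =P y) => [->|/eqP xy].
  apply: leq_trans (leq_addl _ _).
  by rewrite [e z y]e_sym [e w y]e_sym; case: (e y z); case: (e y w).
case: (z =P w) => [->|/eqP zw].
  by apply: leq_trans (leq_addl _ _); case: (e x w); case: (e w y).
rewrite /c4q [e y w]e_sym [e w x]e_sym.
case exz: (e x z) => //; case ezy: (e z y) => //; case exw: (e x w) => //.
case ewy: (e w y) => //=; rewrite !inE !negb_or xy zw /= !andbT.
have xz : x != z by apply: contraTneq exz => ->; rewrite e_irr.
have zy : z != y by apply: contraTneq ezy => ->; rewrite e_irr.
have xw : x != w by apply: contraTneq exw => ->; rewrite e_irr.
have yw : y != w by apply: contraTneq ewy => ->; rewrite e_irr.
by rewrite xz zy xw yw.
Qed.

(** Double counting: [sqdeg U] is the sum of the codegrees over the pairs [(x, y)] of [U], while the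
    sum of their squares counts pairs of 2-walks with common ends, which [cod_split] bounds. *)
Lemma sqdeg_supersat (U : {set T}) :
  sqdeg U ^ 2 <= #|U| ^ 2 * (numc4q + 2 * sqdeg U).
Proof.
pose cod x y := \sum_(z in U) e x z * e z y.
have codE : \sum_(x in U) \sum_(y in U) cod x y = sqdeg U.
  rewrite /cod /sqdeg.
  under eq_bigr do rewrite exchange_big /=.
  rewrite exchange_big /=; apply: eq_bigr => z _.
  under eq_bigr do rewrite -big_distrr /=.
  rewrite -big_distrl /= -mulnn; congr (_ * _).
  by apply: eq_bigr => x _; rewrite e_sym.
have sqE : \sum_(x in U) \sum_(y in U) cod x y ^ 2 <= numc4q + 2 * sqdeg U.
  have -> : \sum_(x in U) \sum_(y in U) cod x y ^ 2 = 
    \sum_(x in U) \sum_(z in U) \sum_(y in U) \sum_(w in U)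
      (e x z * e z y) * (e x w * e w y).
    apply: eq_bigr => x _; rewrite exchange_big /=.
    by apply: eq_bigr => y _; rewrite -mulnn big_distrlr.
  (* The pairs with [x = y] contribute the sum of the squared degrees, those with [z = w] the sum of
     the codegrees; both equal [sqdeg U]. *)
  have -> : 2 * sqdeg U =
    \sum_(x in U) \sum_(z in U) \sum_(y in U) \sum_(w in U)
      ((x == y) * (e x z * e x w) + (z == w) * (e x z * e z y)).
    rewrite mul2n -addnn -{2}codE /cod /sqdeg -big_split /=.
    apply: eq_bigr => x xU.
    under [RHS]eq_bigr do
      (under eq_bigr do rewrite big_split /=; rewrite big_split /=).
    rewrite big_split /=; congr (_ + _).
      rewrite /degin -mulnn big_distrlr /=; apply: eq_bigr => z _.
      rewrite [RHS](bigD1 x) //= eqxx [X in _ = _ + X]big1 ?addn0.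
        by apply: eq_bigr => w _; rewrite mul1n.
      by move=> y /andP[_ yx]; apply: big1 => w _; rewrite eq_sym (negPf yx).
    rewrite exchange_big /=; apply: eq_bigr => z zU; apply: eq_bigr => y yU.
    rewrite [RHS](bigD1 z) //= eqxx [X in _ = _ + X]big1 ?addn0 ?mul1n //.
    by move=> w /andP[_ wz]; rewrite eq_sym (negPf wz).
  pose D x z y w := (x == y) * (e x z * e x w) + (z == w) * (e x z * e z y) : nat.
  apply: (@leq_trans (\sum_(x in U) \sum_(z in U) \sum_(y in U) \sum_(w in U)
       (c4q x z y w + D x z y w))).
    do 4!(apply: leq_sum => ? ?).
    exact: cod_split.
  under eq_bigr do (under eq_bigr do (under eq_bigr do rewrite big_split /=;
    rewrite big_split /=); rewrite big_split /=).
  rewrite big_split /= leq_add2r /numc4q.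
  by do 4!(apply: leq_trans (leq_sum_setT _ _); apply: leq_sum => ? _).
(* Cauchy-Schwarz is applied to the sum over [x], then to each sum over [y]; each use costs a factor
   [#|U|]. *)
apply: leq_trans (_ : #|U| ^ 2 * \sum_(x in U) \sum_(y in U) cod x y ^ 2 <= _); last first.
  by rewrite leq_mul2l sqE orbT.
rewrite -codE expnS expn1 -mulnA.
apply: leq_trans (sum_sqr_le _ _) _; rewrite leq_mul2l; apply/orP; right.
rewrite big_distrr /=; apply: leq_sum => x _; exact: sum_sqr_le.
Qed.

Variable t : nat.
Hypothesis numc4q_le : numc4q <= 8 * t.

(** With [a = #|U|^2] and [b = sqdeg U]: if [4 a < b], then [2 a b] is at most half of [b^2], so
    that [b^2 <= 8 a t + 2 a b] leaves [b^2 <= 16 a t]. *)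
Lemma sqdeg_cases (U : {set T}) :
  sqdeg U <= 4 * #|U| ^ 2 \/ sqdeg U ^ 2 <= 16 * (#|U| ^ 2 * t).
Proof.
have H := sqdeg_supersat U.
have [?|lt] := leqP (sqdeg U) (4 * #|U| ^ 2); [by left | right].
have {}H : sqdeg U ^ 2 <= #|U| ^ 2 * (8 * t + 2 * sqdeg U).
  by apply: leq_trans H _; rewrite leq_mul2l leq_add2r numc4q_le orbT.
move: (#|U| ^ 2) (sqdeg U) H lt => a b; rewrite -mulnn; nia.
Qed.

Definition deg z := \sum_b e z b.

Lemma deg_le_card z : deg z <= #|T|.
Proof. by rewrite /deg -sum1_card; apply: leq_sum => b _; case: (e z b). Qed.

Variable r : rel T.
Hypothesis r_deg : forall z b, e z b -> r z b -> deg z <= deg b.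

(** The quantity [W] of the overview, where [r z b] will say that [b] is above [z]. *)
Definition work := \sum_z deg z * \sum_b (e z b && r z b).

Lemma work_le_dense : work <= 4 * (#|T| ^ 2 + t).
Proof.
have degE z : degin setT z = deg z.
  by apply: eq_bigl => b; rewrite inE.
apply: (@leq_trans (sqdeg setT)).
  rewrite /work /sqdeg [leqRHS](eq_bigl predT) => [|z]; last by rewrite inE.
  apply: leq_sum => z _; rewrite degE -mulnn leq_mul2l; apply/orP; right.
  by apply: leq_sum => b _; case: (e z b) => //=; case: (r z b).
case: (sqdeg_cases setT); rewrite cardsT; first by lia.
rewrite -(leq_sqr (sqdeg _)) => /leq_trans; apply.
(* By the arithmetic-geometric inequality, [16 n^2 t <= (4 (n^2 + t))^2]. *)
have := nat_Cauchy (#|T| ^ 2) t => -[H _].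
move: (#|T| ^ 2) H => a; rewrite -!mulnn; nia.
Qed.

Definition level i := [set z | 2 ^ i <= deg z].
Definition leveldeg i := \sum_(z in level i) degin (level i) z.

(** [Y] plays the role of [s^(4/3)], with [s] the degree sum; the hypothesis in integer powers
    avoids roots. Everything follows from [N p <= s] and [e1^2 <= N Q], where [p = 2^i], [N] is the
    size of the level, [e1] its inner degree sum and [Q] its [sqdeg]. *)
Lemma level_bound i Y : (\sum_z deg z) ^ 4 <= Y ^ 3 ->
  2 ^ i * leveldeg i <= 2 * (Y + t).
Proof.
set s := \sum_z deg z => sY.
have degin_le z : degin (level i) z <= deg z by apply: leq_sum_setT.
have es : leveldeg i <= s.
  apply: leq_trans (leq_sum_setT _ _); exact: leq_sum.
have Ns : #|level i| * 2 ^ i <= s.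
  rewrite -sum_nat_const; apply: leq_trans (leq_sum_setT (level i) _).
  by apply: leq_sum => z; rewrite inE.
have eQ : leveldeg i ^ 2 <= #|level i| * sqdeg (level i) by exact: sum_sqr_le.
case: (sqdeg_cases (level i)); move: eQ Ns es sY.
all: move: (leveldeg i) (#|level i|) (sqdeg _) s (2 ^ i) => {degin_le} e1 N Q s p.
  move=> eQ Ns es sY QN.
  (* If [p^3 <= s], the trivial bound [e1 <= s] suffices: [(p e1)^3 <= s^4]. *)
  have [ps|ps] := leqP (p ^ 3) s.
    apply: (@leq_trans Y); last by lia.
    rewrite -(leq_exp2r _ _ (isT : 0 < 3)); apply: leq_trans sY.
    by rewrite expnMn (expnS s 3) leq_mul // leq_exp2r.
  case: (posnP s) => [s0|s_gt0]; first by nia.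
  apply: (@leq_trans (2 * Y)); last by lia.
  (* Here [Q <= 4 N^2], hence [e1^2 <= 4 N^3], and [N p <= s] is used three times. Cubing and using
     [s < p^3] then gives [(p e1)^6 <= 64 s^8 <= (2 Y)^6]. *)
  have H1 : (p * e1) ^ 2 * p <= 4 * s ^ 3.
    have : e1 ^ 2 <= 4 * N ^ 3 by rewrite -!mulnn in QN *; rewrite !expnS expn0; nia.
    move=> H; apply: (@leq_trans (4 * (N * p) ^ 3)).
      by rewrite !expnMn; move: (e1 ^ 2) (N ^ 3) H => a b H; rewrite !expnS !expn0; nia.
    by rewrite leq_mul2l /= leq_exp2r.
  have H2 : (p * e1) ^ 6 * s <= 64 * s ^ 8 * s.
    apply: (@leq_trans (((p * e1) ^ 2 * p) ^ 3)).
      by rewrite [in leqRHS]expnMn -expnM leq_mul2l ltnW ?orbT.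
    apply: (@leq_trans ((4 * s ^ 3) ^ 3)); first by rewrite leq_exp2r.
    by rewrite expnMn -expnM -mulnA -expnSr.
  rewrite leq_pmul2r // in H2.
  rewrite -(leq_exp2r _ _ (isT : 0 < 6)); apply: leq_trans H2 _.
  by rewrite [leqRHS]expnMn leq_mul2l /= (expnM s 4 2) (expnM Y 3 2) leq_exp2r.
move=> eQ Ns es sY QN.
rewrite -(leq_exp2r _ _ (isT : 0 < 4)).
(* Now [Q^2 <= 16 N^2 t], so [e1^4 <= (N Q)^2 <= 16 N^4 t], and [N p <= s] is used four times. *)
apply: (@leq_trans (16 * (s ^ 4 * t))).
  have : e1 ^ 4 <= 16 * (N ^ 4 * t).
    apply: (@leq_trans ((N * Q) ^ 2)); first by rewrite (expnM e1 2 2) leq_exp2r.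
    rewrite expnMn (expnM N 2 2) -mulnn; move: QN; nia.
  move=> H; apply: (@leq_trans (16 * ((N * p) ^ 4 * t))).
    by rewrite !expnMn; move: (e1 ^ 4) (N ^ 4) (p ^ 4) H => a b c; nia.
  by rewrite leq_mul2l leq_mul2r leq_exp2r // Ns orbT.
rewrite [leqRHS]expnMn leq_mul2l /=.
apply: (@leq_trans (Y ^ 3 * t)); first by rewrite leq_mul2r sY orbT.
rewrite (expnSr _ 3); apply: leq_mul; last by lia.
by rewrite leq_exp2r // leq_addr.
Qed.

(** A vertex [z] of positive degree is charged to its top level [i], for which [deg z < 2 * 2^i]. By
    [r_deg] every neighbour above [z] lies in that level too, so it is counted in
    [degin (level i) z]. *)
Lemma work_le_sparse K Y : (forall z, deg z < 2 ^ K) ->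
  (\sum_z deg z) ^ 4 <= Y ^ 3 -> work <= 4 * K * (Y + t).
Proof.
move=> degK sY.
apply: (@leq_trans (\sum_(i < K) 2 * (2 ^ i * leveldeg i))); last first.
  apply: (@leq_trans (\sum_(i < K) 4 * (Y + t))).
    by apply: leq_sum => i _; have := level_bound i sY; lia.
  by rewrite sum_nat_const card_ord; lia.
rewrite /work /leveldeg.
under [leqRHS]eq_bigr do rewrite mulnA big_distrr big_mkcond /=.
rewrite exchange_big; apply: leq_sum => z _ /=.
case: (posnP (deg z)) => [-> //|d_gt0].
have /andP[lo hi] := trunc_log_bounds (isT : 1 < 2) d_gt0.
have iK : trunc_log 2 (deg z) < K.
  by rewrite -(ltn_exp2l _ _ (isT : 1 < 2)); apply: leq_ltn_trans lo _.
rewrite (bigD1 (Ordinal iK)) //= inE lo.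
apply: leq_trans (leq_addr _ _); rewrite -expnS; apply: leq_mul; first exact: ltnW.
rewrite /degin [leqRHS]big_mkcond /=; apply: leq_sum => b _; rewrite inE.
case ezb: (e z b) => //=; case rzb: (r z b) => //=.
by rewrite (leq_trans lo) // r_deg.
Qed.

End Supersaturation.

(** * The eight labellings of a 4-cycle *)

Definition dihedral n (q : quad n) : seq (quad n) :=
  let: (a, b, c, d) := q in
  [:: (a, b, c, d); (b, c, d, a); (c, d, a, b); (d, a, b, c);
      (d, c, b, a); (c, b, a, d); (b, a, d, c); (a, d, c, b)].

Lemma set2_eqP (T : finType) (x y u v : T) :
  [set x; y] = [set u; v] -> (x = u /\ y = v) \/ (x = v /\ y = u).
Proof.
move=> E.
have := set21 x y; have := set22 x y; rewrite E !inE.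
have := set21 u v; have := set22 u v; rewrite -E !inE.
by do 4!(case/orP => /eqP ?); subst; auto.
Qed.

Lemma mem_c4_edges n (a b c d x y : 'I_n) :
  [set x; y] \in c4_edges a b c d ->
  [\/ (x = a /\ y = b) \/ (x = b /\ y = a), (x = b /\ y = c) \/ (x = c /\ y = b),
      (x = c /\ y = d) \/ (x = d /\ y = c) | (x = d /\ y = a) \/ (x = a /\ y = d)].
Proof.
rewrite /c4_edges !inE -!orbA => /or4P[] /eqP /set2_eqP H;
  [exact: Or41 | exact: Or42 | exact: Or43 | exact: Or44].
Qed.

(** The edge [a' b'] must be one of the four edges of [p], in one of two directions; the next two
    edges then force [c'] and [d']. *)
Lemma c4_edges_dihedral n (p q : quad n) :
  uniq [:: p.1.1.1; p.1.1.2; p.1.2; p.2] ->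
  uniq [:: q.1.1.1; q.1.1.2; q.1.2; q.2] ->
  q_edges q = q_edges p -> q \in dihedral p.
Proof.
case: p q => [[[a b] c] d] [[[a' b'] c'] d'] /=.
rewrite !inE !negb_or !andbT -!andbA.
case/and4P => /eqP ab /eqP ac /eqP ad /and3P[/eqP bc /eqP bd /eqP cd].
case/and4P => /eqP ab' /eqP ac' /eqP ad' /and3P[/eqP bc' /eqP bd' /eqP cd'] E.
have /mem_c4_edges E1 : [set a'; b'] \in c4_edges a b c d
  by rewrite -[c4_edges _ _ _ _]E !inE eqxx.
have /mem_c4_edges E2 : [set b'; c'] \in c4_edges a b c d
  by rewrite -[c4_edges _ _ _ _]E !inE eqxx ?orbT.
have /mem_c4_edges E3 : [set c'; d'] \in c4_edges a b c d
  by rewrite -[c4_edges _ _ _ _]E !inE eqxx ?orbT.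
by case: E1 => -[[? ?]|[? ?]]; subst; case: E2 => -[[? ?]|[? ?]]; subst; try congruence;
  case: E3 => -[[? ?]|[? ?]]; subst; try congruence; rewrite eqxx ?orbT.
Qed.

Lemma C4P n (E : rel 'I_n) S :
  reflect (exists2 q, q_ok E q & S = q_edges q) (S \in C4 E).
Proof.
rewrite inE; apply: (iffP existsP).
  by case=> a /existsP[b /existsP[c /existsP[d /andP[ok /eqP ->]]]]; exists (a, b, c, d).
case=> -[[[a b] c] d] ok ->; exists a; apply/existsP; exists b.
by apply/existsP; exists c; apply/existsP; exists d; rewrite [is_c4 _ _ _ _ _]ok /= eqxx.
Qed.

(** The labelled cycles are grouped by edge set; each fibre lies in one [dihedral] orbit, of size
    8. *)
Lemma numc4q_C4 n (E : rel 'I_n) : numc4q E <= 8 * #|C4 E|.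
Proof.
have -> : numc4q E = \sum_(q | q_ok E q) 1.
  rewrite /numc4q !pair_big /= [RHS]big_mkcond; apply: eq_bigr => q _.
  by rewrite -[c4q _ _ _ _ _]/(q_ok E q); case: (q_ok E q).
rewrite (partition_big (@q_edges n) (fun S => S \in C4 E)) /=; last first.
  by move=> q ok; apply/C4P; exists q.
rewrite mulnC -sum_nat_const; apply: leq_sum => S /C4P[p okp ->].
rewrite sum1_card; apply: (@leq_trans (size (dihedral p))); last by case: p {okp} => [[[]]].
apply: leq_trans (card_size _); apply: subset_leq_card; apply/subsetP => q.
rewrite unfold_in => /andP[okq /eqP]; apply: c4_edges_dihedral.
  by case/and5P: okp.
by case/and5P: okq.
Qed.

(** * Stored 2-paths and reported 4-cycles *)

(** An event [(z, b, d)] is the processing of the 2-path b - z - d, middle vertex first; a quadruple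
    [(b, z, d, w)] is in cyclic order. *)
Notation event := (nat * nat * nat)%type.
Notation quadn := (nat * nat * nat * nat)%type.

Definition lst (l : seq event) (b d : nat) : seq nat :=
  [seq e.1.1 | e <- l & (e.1.2 == b) && (e.2 == d)].

(** The list is reversed because the program scans it from its last entry down. *)
Definition newq (l : seq event) (e : event) : seq quadn :=
  [seq (e.1.2, e.1.1, e.2, w) | w <- rev (lst l e.1.2 e.2)].

Fixpoint outs (past l : seq event) : seq quadn :=
  if l is e :: l' then newq past e ++ outs (rcons past e) l' else [::].

Lemma lst_rcons l e b d :
  lst (rcons l e) b d =
  if (e.1.2 == b) && (e.2 == d) then rcons (lst l b d) e.1.1 else lst l b d.
Proof. by rewrite /lst filter_rcons; case: ifP => //; rewrite map_rcons. Qed.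

Lemma mem_lst l z b d : (z \in lst l b d) = ((z, b, d) \in l).
Proof.
apply/mapP/idP => [[[[z' b'] d']]|zl].
  by rewrite mem_filter /= => /andP[/andP[/eqP -> /eqP ->] ?] ->.
by exists (z, b, d); rewrite // mem_filter /= !eqxx.
Qed.

Lemma uniq_lst l b d : uniq l -> uniq (lst l b d).
Proof.
move=> ul; rewrite map_inj_in_uniq ?filter_uniq // => -[[z1 b1] d1] [[z2 b2] d2].
by rewrite !mem_filter /= => /andP[/andP[/eqP -> /eqP ->] _] /andP[/andP[/eqP -> /eqP ->] _] ->.
Qed.

(** The entries of a list are distinct middle vertices. This is why [n + 1] cells per pair, one of
    them for the size, never overflow. *)
Lemma size_lst n l b d :
  uniq l -> all (fun e : event => e.1.1 < n) l -> size (lst l b d) <= n.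
Proof.
move=> ul /allP ln; rewrite -[leqRHS](size_iota 0) uniq_leq_size ?uniq_lst //.
by move=> z; rewrite mem_lst mem_iota => /ln.
Qed.

Lemma outs_cat past l1 l2 :
  outs past (l1 ++ l2) = outs past l1 ++ outs (past ++ l1) l2.
Proof.
elim: l1 past => [|e l1 IH] past /=; first by rewrite cats0.
by rewrite IH -catA -cats1 -catA.
Qed.

Lemma outs_rcons l e : outs [::] (rcons l e) = outs [::] l ++ newq l e.
Proof. by rewrite -cats1 outs_cat /= cats0. Qed.

Lemma mem_newq l z b d b' z' d' w :
  ((b, z, d, w) \in newq l (z', b', d')) =
  [&& b == b', z == z', d == d' & (w, b', d') \in l].
Proof.
apply/mapP/and4P => [[x]|[/eqP -> /eqP -> /eqP -> wl]].
  by rewrite mem_rev mem_lst /= => xl [-> -> -> ->].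
by exists w; rewrite // mem_rev mem_lst.
Qed.

(** Of the two events with ends [b] and [d] and middles [z] and [w], only the later one reports the
    cycle. The strict inequality of indices also forces [(w, b, d)] to be in [l]. *)
Lemma mem_outs l z b d w : uniq l ->
  ((b, z, d, w) \in outs [::] l) =
  ((z, b, d) \in l) && (index (w, b, d) l < index (z, b, d) l).
Proof.
elim/last_ind: l => [//|l e IH]; rewrite rcons_uniq => /andP[el ul].
rewrite outs_rcons mem_cat IH // mem_rcons inE -!cats1 !index_cat /=.
case: e el => -[z' b'] d' el; rewrite mem_newq.
have [E|ne] := eqVneq (z, b, d) (z', b', d').
  case: E => -> -> ->; rewrite !eqxx (negPf el) /= addn0.
  case: ifP => wl; first by rewrite index_mem.
  by rewrite ltnNge leq_addr.
have -> : [&& b == b', z == z', d == d' & (w, b', d') \in l] = false.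
  by apply: contraNF ne => /and4P[/eqP -> /eqP -> /eqP -> _].
rewrite orbF /=; case zl: ((z, b, d) \in l) => //=.
have zl' : index (z, b, d) l < size l by rewrite index_mem.
case: ifP => // wl; rewrite (memNindex (negbT wl)) !ltnNge (ltnW zl').
by rewrite (leq_trans (ltnW zl') (leq_addr _ _)).
Qed.

Lemma uniq_outs l : uniq l -> uniq (outs [::] l).
Proof.
elim/last_ind: l => [//|l e IH]; rewrite rcons_uniq => /andP[el ul].
rewrite outs_rcons cat_uniq IH //= andbC.
rewrite map_inj_uniq ?rev_uniq ?uniq_lst //=; last by move=> x y [].
apply/hasPn => -[[[b z] d] w]; case: e el => -[z' b'] d' el.
rewrite mem_newq => /and4P[/eqP -> /eqP -> /eqP -> _].
by rewrite mem_outs // (negPf el).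
Qed.

(** The order in which the program meets the vertices. It runs through the concatenated lists rather
    than through all names, so isolated vertices cost nothing; otherwise the time would contain [n],
    which is not bounded in terms of [m]. *)
Fixpoint visit (vis ds : seq nat) : seq nat :=
  if ds is z :: ds' then
    if z \in vis then visit vis ds' else z :: visit (z :: vis) ds'
  else [::].

Lemma mem_visit vis ds z : (z \in visit vis ds) = (z \in ds) && (z \notin vis).
Proof.
elim: ds vis => [//|y ds IH] vis /=; rewrite inE.
case: ifP => yv; rewrite ?inE IH.
  by have [->|//] := eqVneq z y; rewrite yv /= andbF.
rewrite inE; case: (eqVneq z y) => [->|//] /=.
by rewrite yv.
Qed.

Lemma uniq_visit vis ds : uniq (visit vis ds).
Proof.
elim: ds vis => [//|y ds IH] vis /=; case: ifP => yv //=.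
by rewrite IH mem_visit inE eqxx /= andbF.
Qed.

(** * The program *)

(* Registers: 1 = 1, 2 = S = n+1, 3 = B0 = end of the input, 4 = position in the
   concatenated lists, 5 = z, 6 and 7 = bounds of the list of z, 8 = key z,
   9 = position of b, 10 = b, 11 = key b, 12 = position of d, 13 = d, 14 = key d,
   15 = address of the list of (b, d), 16 = its size; the others are temporary.
   The list of (b, d) starts at address (b S + d) S + B0, with its size first.
   Since b != d there, the cell (z, z) is free to record that z has been met. *)
Definition c4prog : seq instr :=
  [:: IConst 1 1; ILoad 2 0; IAdd 2 2 1; ILoad 3 2; IAdd 4 2 1;
  (* 5: next entry z *)
      ISub 18 3 4; IJz 18 72; ILoad 5 4; IAdd 4 4 1;
      IMul 18 5 2; IAdd 18 18 5; IMul 18 18 2; IAdd 18 18 3;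
      ILoad 19 18; IJz 19 16; IJmp 5;
      IStore 18 1; IAdd 18 5 1; ILoad 6 18; IAdd 18 18 1; ILoad 7 18;
      ISub 8 7 6; IMul 8 8 2; IAdd 8 8 5; IAdd 9 6 0;
  (* 25: next neighbour b of z *)
      ISub 18 7 9; IJz 18 5; ILoad 10 9; IAdd 9 9 1;
      IAdd 18 10 1; ILoad 19 18; IAdd 18 18 1; ILoad 11 18;
      ISub 11 11 19; IMul 11 11 2; IAdd 11 11 10;
      ISub 18 11 8; IJz 18 25; IAdd 12 6 0;
  (* 39: next neighbour d of z *)
      ISub 18 7 12; IJz 18 25; ILoad 13 12; IAdd 12 12 1;
      IAdd 18 13 1; ILoad 19 18; IAdd 18 18 1; ILoad 14 18;
      ISub 14 14 19; IMul 14 14 2; IAdd 14 14 13;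
      ISub 18 11 14; IJz 18 39;
      IMul 15 10 2; IAdd 15 15 13; IMul 15 15 2; IAdd 15 15 3;
      ILoad 16 15; IAdd 17 16 0;
  (* 58: output b z d w for the stored w *)
      IJz 17 67; IAdd 18 15 17; ILoad 20 18;
      IOut 10; IOut 5; IOut 13; IOut 20; ISub 17 17 1; IJmp 58;
  (* 67: append z to the list of (b, d) *)
      IAdd 16 16 1; IStore 15 16; IAdd 18 15 16; IStore 18 5; IJmp 39;
      IHalt].

(** * Effect of the code blocks *)

Lemma steps_cat M P k1 k2 s s1 s2 :
  steps M P k1 s = Some s1 -> steps M P k2 s1 = Some s2 ->
  steps M P (k1 + k2) s = Some s2.
Proof.
elim: k1 s => [|k IH] s /=; first by case=> ->.
by case: (step M P s) => // s'; apply: IH.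
Qed.

Definition words (q : quadn) : seq nat := [:: q.1.1.1; q.1.1.2; q.1.2; q.2].

(* Inner loops only write to registers of larger index, so that the invariants of
   a loop are carried through its body by [agree]. *)
Definition agree (m : nat) (r r' : nat -> nat) := forall x, x < m -> r' x = r x.

Lemma agree_trans m p r1 r2 r3 :
  m <= p -> agree m r1 r2 -> agree p r2 r3 -> agree m r1 r3.
Proof. by move=> mp H1 H2 x xm; rewrite H2 ?H1 // (leq_trans xm). Qed.

Ltac solve_agree :=
  let x := fresh "x" in let xlt := fresh "xlt" in
  move=> x xlt; rewrite /upd !ltn_eqF //; by apply: leq_trans xlt _.

Section Exec.
Variable M : nat.
Local Notation P := c4prog.

Lemma stepJz k p r mm o a l : nth IHalt P p = IJz a l ->
  steps M P k.+1 (State p r mm o) =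
  steps M P k (State (if r a == 0 then l else p.+1) r mm o).
Proof. by move=> E /=; rewrite E. Qed.

(** Register 17 counts down from the size of the list; each stored word takes 9 steps, and the final
    zero test takes one. *)
Lemma run_out q r mm o : r 1 = 1 -> r 17 = q -> r 15 + q < M ->
  exists2 r', steps M P (9 * q + 1) (State 58 r mm o) =
    Some (State 67 r' mm (o ++ flatten [seq [:: r 10; r 5; r 13; w] |
            w <- rev [seq mm (r 15 + i.+1) | i <- iota 0 q]])) &
    agree 17 r r'.
Proof.
elim: q r o => [|q IH] r o r1 r17 ltM.
  by exists r; rewrite ?(stepJz _ _ _ _ (erefl : nth IHalt P 58 = _)) ?r17 ?cats0.
have -> : 9 * q.+1 + 1 = (8 + (9 * q + 1)).+1 by lia.
rewrite (stepJz _ _ _ _ (erefl : nth IHalt P 58 = _)) r17.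
set r2 := upd (upd (upd r 18 (r 15 + q.+1)) 20 (mm (r 15 + q.+1))) 17 q.
set o2 := o ++ [:: r 10; r 5; r 13; mm (r 15 + q.+1)].
have E1 : steps M P 8 (State 59 r mm o) = Some (State 58 r2 mm o2).
  transitivity (Some (State 58
    (upd (upd (upd r 18 ((r 15 + r 17) %% M)) 20 (mm ((r 15 + r 17) %% M))) 17
      (r 17 - r 1)) mm
    (rcons (rcons (rcons (rcons o (r 10)) (r 5)) (r 13)) (mm ((r 15 + r 17) %% M))))); first by [].
  by rewrite r17 r1 subn1 modn_small // -!cats1 -!catA.
have [||| r' E2 ag] := IH r2 o2; rewrite ?/r2 //.
  by rewrite /upd /= (leq_ltn_trans _ ltM) // leq_add2l.
exists r'.
  rewrite (steps_cat E1 E2); congr (Some (State _ _ _ _)).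
  rewrite /o2 -catA; congr (_ ++ _).
  have -> : iota 0 q.+1 = iota 0 q ++ [:: q] by rewrite -addn1 iotaD.
  by rewrite map_cat rev_cat.
apply: agree_trans ag => // x xlt; rewrite /r2 /upd !ltn_eqF //; lia.
Qed.

(** Truncated subtraction makes a bound test out of a zero test: the difference vanishes once the
    position has reached the bound. *)
Lemma test_z r mm o : steps M P 2 (State 5 r mm o) =
  Some (State (if r 3 - r 4 == 0 then 72 else 7) (upd r 18 (r 3 - r 4)) mm o).
Proof. by []. Qed.

Lemma test_b r mm o : steps M P 2 (State 25 r mm o) =
  Some (State (if r 7 - r 9 == 0 then 5 else 27) (upd r 18 (r 7 - r 9)) mm o).
Proof. by []. Qed.

Lemma test_d r mm o : steps M P 2 (State 39 r mm o) =
  Some (State (if r 7 - r 12 == 0 then 25 else 41) (upd r 18 (r 7 - r 12)) mm o).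
Proof. by []. Qed.

Lemma branch_z r mm o : steps M P 1 (State 14 r mm o) =
  Some (State (if r 19 == 0 then 16 else 15) r mm o).
Proof. by []. Qed.

Lemma branch_b r mm o : steps M P 1 (State 37 r mm o) =
  Some (State (if r 18 == 0 then 25 else 38) r mm o).
Proof. by []. Qed.

Lemma branch_d r mm o : steps M P 1 (State 51 r mm o) =
  Some (State (if r 18 == 0 then 39 else 52) r mm o).
Proof. by []. Qed.

Lemma step38 r mm o : steps M P 1 (State 38 r mm o) =
  Some (State 39 (upd r 12 ((r 6 + r 0) %% M)) mm o).
Proof. by []. Qed.

Lemma step15 r mm o : steps M P 1 (State 15 r mm o) = Some (State 5 r mm o).
Proof. by []. Qed.

(* [key x] as the program computes it from the row bounds stored in memory. *)
Definition kof (mm : nat -> nat) one S x :=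
  ((mm (((x + one) %% M + one) %% M) - mm ((x + one) %% M)) * S %% M + x) %% M.

(** The block lemmas keep every reduction modulo [M], so that they hold by evaluation; absence of
    overflow is proved where they are applied. *)
Lemma block_d r mm o : exists r', [/\
  steps M P 10 (State 41 r mm o) = Some (State 51 r' mm o), agree 12 r r',
  r' 12 = (r 12 + r 1) %% M, r' 13 = mm (r 12) &
  r' 18 = r 11 - kof mm (r 1) (r 2) (mm (r 12))].
Proof. by eexists; split; [reflexivity | solve_agree | | |]. Qed.

Lemma block_cell r mm o : exists r',
  let a := (((r 10 * r 2) %% M + r 13) %% M * r 2 %% M + r 3) %% M in [/\
  steps M P 6 (State 52 r mm o) = Some (State 58 r' mm o), agree 15 r r',
  r' 15 = a, r' 16 = mm a & r' 17 = (mm a + r 0) %% M].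
Proof. by eexists; split; [reflexivity | solve_agree | | |]. Qed.

Lemma block_push r mm o : exists r',
  let c := (r 16 + r 1) %% M in [/\
  steps M P 5 (State 67 r mm o) =
    Some (State 39 r' (upd (upd mm (r 15) c) ((r 15 + c) %% M) (r 5)) o) &
  agree 16 r r'].
Proof. by eexists; split; [reflexivity | solve_agree]. Qed.

Lemma block_b r mm o : exists r', [/\
  steps M P 10 (State 27 r mm o) = Some (State 37 r' mm o), agree 9 r r',
  r' 9 = (r 9 + r 1) %% M, r' 10 = mm (r 9) &
  r' 11 = kof mm (r 1) (r 2) (mm (r 9)) /\
  r' 18 = kof mm (r 1) (r 2) (mm (r 9)) - r 8].
Proof. by eexists; split; [reflexivity | solve_agree | | |]. Qed.

Lemma block_z r mm o : exists r', 
  let a := ((((mm (r 4) * r 2) %% M + mm (r 4)) %% M) * r 2 %% M + r 3) %% M in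
  [/\ steps M P 7 (State 7 r mm o) = Some (State 14 r' mm o), agree 4 r r',
  r' 4 = (r 4 + r 1) %% M, r' 5 = mm (r 4) & r' 18 = a /\ r' 19 = mm a].
Proof. by eexists; split; [reflexivity | solve_agree | | |]. Qed.

Lemma block_mark r mm o : exists r', let mm' := upd mm (r 18) (r 1) in 
  let i0 := mm' ((r 5 + r 1) %% M) in
  let e := mm' (((r 5 + r 1) %% M + r 1) %% M) in
  [/\ steps M P 9 (State 16 r mm o) = Some (State 25 r' mm' o), agree 6 r r',
  r' 6 = i0, r' 7 = e & r' 8 = kof mm' (r 1) (r 2) (r 5) /\ r' 9 = (i0 + r 0) %% M].
Proof. by eexists; split; [reflexivity | solve_agree | | |]. Qed.

Lemma block_init mm : exists r', [/\
  steps M P 5 (State 0 (fun _ => 0) mm [::]) = Some (State 5 r' mm [::]),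
  [/\ r' 0 = 0, r' 1 = 1 %% M & r' 2 = (mm 0 + 1 %% M) %% M],
  r' 3 = mm ((mm 0 + 1 %% M) %% M) & r' 4 = ((mm 0 + 1 %% M) %% M + 1 %% M) %% M].
Proof. by eexists; split; [reflexivity | | |]. Qed.

End Exec.

(** * Execution *)

(** With [N] the input size, [N^3 + N < N^4] because [N >= 3]. List addresses are cubic in [N],
    whence the exponent parameter 3. *)
Lemma word_mod_gt adj x :
  x <= (size adj + sumn (map size adj) + 3) ^ 3 + (size adj + sumn (map size adj) + 3) ->
  x < word_mod 3 adj.
Proof.
rewrite /word_mod; move: (size adj + _) => a /leq_ltn_trans; apply.
rewrite [ltnRHS]expnSr; have : a + 3 <= (a + 3) ^ 3
  by rewrite -{1}(expn1 (a + 3)) leq_pexp2l // addn3.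
move: ((a + 3) ^ 3) => c; nia.
Qed.

(** The projection [p] recovers the block from an element, so distinct blocks are disjoint. *)
Lemma uniq_flatten_proj (T U : eqType) (p : U -> T) (f : T -> seq U) xs :
  uniq xs -> (forall x, x \in xs -> uniq (f x)) ->
  (forall x y, y \in f x -> p y = x) -> uniq (flatten [seq f x | x <- xs]).
Proof.
move=> uxs uf pf; elim: xs uxs uf => [//|x xs IH] /= /andP[xxs uxs] uf.
rewrite cat_uniq uf ?mem_head // IH // => [|y yxs]; last by rewrite uf // inE yxs orbT.
rewrite andbT; apply/hasPn => y /flatten_mapP[x' x'xs yx'].
by apply: contraNN xxs => yx; rewrite -(pf _ _ yx) (pf _ _ yx').
Qed.

Section Ram.
Variable adj : seq (seq nat).
Hypothesis wf : wf_adj adj.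

Local Notation n := (size adj).
Local Notation s := (sumn (map size adj)).
Local Notation nb := (nbrs adj).
Variable M : nat.
Hypothesis small_lt_M : forall x,
  x <= (size adj + sumn (map size adj) + 3) ^ 3 + (size adj + sumn (map size adj) + 3) ->
  x < M.
Local Notation P := c4prog.
Local Notation S := (size adj).+1.
Local Notation B0 := ((size adj).+2 + sumn (map size adj)).

Definition st x := n.+2 + sumn (map size (take x adj)).
Definition mem0 := Defs.mem (init_state adj).
(** The pair (degree, name) as a two-digit number in base [n + 1]: a single comparison decides the
    lexicographic order. *)
Definition key x := size (nb x) * S + x.
(** The digits [b], [d], [i] in base [n + 1], shifted past the input. *)
Definition cell b d i := (b * S + d) * S + B0 + i.

Lemma mem0S j :
  mem0 j.+1 = nth 0 ([seq st i | i <- iota 0 n.+1] ++ flatten adj) j.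
Proof. by []. Qed.

Lemma input_start x : x <= n -> mem0 x.+1 = st x.
Proof.
move=> xn; rewrite mem0S nth_cat size_map size_iota ltnS xn.
by rewrite (nth_map 0) ?size_iota // nth_iota.
Qed.

Lemma size_flat : size (flatten adj) = s.
Proof. by rewrite size_flatten /shape. Qed.

Lemma input_flat i : mem0 (n.+2 + i) = nth 0 (flatten adj) i.
Proof.
rewrite addSn mem0S nth_cat size_map size_iota.
by rewrite ltnNge leq_addr /= addKn.
Qed.

Lemma st_succ x : x < n -> st x.+1 = st x + size (nb x).
Proof.
move=> xn; rewrite /st (take_nth [::]) // map_rcons -cats1 sumn_cat /= addn0.
by rewrite addnA.
Qed.

Lemma st_size : st n = B0.
Proof. by rewrite /st take_size. Qed.

Lemma st_le x y : x <= y -> st x <= st y.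
Proof.
move=> xy; rewrite /st leq_add2l -(subnKC xy) takeD map_cat sumn_cat.
exact: leq_addr.
Qed.

Lemma st_leB0 x : st x <= B0.
Proof.
have [xn|xn] := leqP x n; first by rewrite -st_size st_le.
by rewrite /st take_oversize // ltnW.
Qed.

Lemma input_nbrs x i : x < n -> i < size (nb x) -> mem0 (st x + i) = nth 0 (nb x) i.
Proof.
move=> xn i_lt; rewrite /st -addnA input_flat.
rewrite -{1}(cat_take_drop x adj) flatten_cat nth_cat size_flatten /shape.
rewrite ltnNge leq_addr /= addKn (drop_nth [::]) //=.
by rewrite nth_cat i_lt.
Qed.

Lemma deg_le x : x < n -> size (nb x) <= s.
Proof. by move=> xn; have := st_succ xn; have := st_leB0 x.+1; rewrite /st; lia. Qed.

Lemma cell_lt b d i : b < n -> d < n -> i <= n -> cell b d i < M.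
Proof.
move=> bn dn i_le; apply: small_lt_M; rewrite /cell.
have H1 : b * S + d < n * S.
  by have := leq_mul bn (leqnn S); rewrite mulSn; lia.
have H2 : (b * S + d) * S + i < n * S * S.
  by have := leq_mul H1 (leqnn S); rewrite mulSn; lia.
have H3 : n * S * S <= (n + s + 3) ^ 3.
  rewrite !expnSr expn0 mul1n !leq_mul //; lia.
lia.
Qed.

Lemma key_lt x : x < n -> key x < M.
Proof.
move=> xn; apply: small_lt_M; have := deg_le xn; rewrite /key => dx.
apply: leq_trans (leq_addr _ _).
apply: (@leq_trans ((n + s + 3) ^ 2)); last by rewrite leq_pexp2l // addn3.
rewrite -mulnn; apply: (@leq_trans (s * S + S)).
  by apply: leq_add; [exact: leq_mul | lia].
by rewrite -mulSnr; apply: leq_mul; lia.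
Qed.

Lemma addr_lt x : x <= B0 -> x < M.
Proof. move=> H; apply: small_lt_M; apply: leq_trans (leq_addl _ _); lia. Qed.

Lemma cell_inj b d i b' d' i' :
  d < n -> d' < n -> i <= n -> i' <= n -> cell b d i = cell b' d' i' ->
  [/\ b = b', d = d' & i = i'].
Proof.
move=> dn dn' i_le i_le' E.
have eucl a c a' c' : c <= n -> c' <= n -> a * S + c = a' * S + c' -> a = a' /\ c = c'.
  move=> cS cS' E'; have := congr1 (divn^~ S) E'; have := congr1 (modn^~ S) E'.
  by rewrite /= !modnMDl !divnMDl // !modn_small // !divn_small // !addn0.
have E1 : (b * S + d) * S + i = (b' * S + d') * S + i' by move: E; rewrite /cell; lia.
have [E2 Ei] := eucl _ _ _ _ i_le i_le' E1.
by have [Eb Ed] := eucl _ _ _ _ (ltnW dn) (ltnW dn') E2.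
Qed.

Lemma B0_cell b d i : B0 <= cell b d i. Proof. rewrite /cell; lia. Qed.

(** The diagonal blocks are exempt from the list clauses, which leaves room for the visit marks. *)
Definition mem_ok (vis : seq nat) (l : seq event) (mm : nat -> nat) :=
  [/\ forall x, x < B0 -> mm x = mem0 x,
      forall x, x < n -> (mm (cell x x 0) == 0) = (x \notin vis),
      forall b d, b < n -> d < n -> b != d -> mm (cell b d 0) = size (lst l b d) &
      forall b d i, b < n -> d < n -> b != d -> i < size (lst l b d) ->
        mm (cell b d i.+1) = nth 0 (lst l b d) i].

Definition ev_ok (l : seq event) := uniq l /\ all (fun e : event => e.1.1 < n) l.

Lemma ev_ok_catl l1 l2 : ev_ok (l1 ++ l2) -> ev_ok l1.
Proof. by case; rewrite cat_uniq all_cat => /andP[? _] /andP[? _]. Qed.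

Lemma mem_ok_mark vis l mm z : ev_ok l -> z < n -> mem_ok vis l mm ->
  mem_ok (z :: vis) l (upd mm (cell z z 0) 1).
Proof.
move=> [ul al] zn [m1 m2 m3 m4]; split.
- by move=> x xB; rewrite /upd ltn_eqF ?m1 // (leq_trans xB) // B0_cell.
- move=> x xn; rewrite /upd inE negb_or -m2 //.
  have [->|xz] := eqVneq x z; first by rewrite eqxx.
  case: (cell x x 0 =P _) => // E.
  by have [Ex _ _] := cell_inj xn zn (leq0n _) (leq0n _) E; rewrite Ex eqxx in xz.
- move=> b d bn dn bd; rewrite /upd; case: eqP => [E|_]; last exact: m3.
  by have [Eb Ed _] := cell_inj dn zn (leq0n _) (leq0n _) E; rewrite Eb Ed eqxx in bd.
- move=> b d i bn dn bd i_lt; rewrite /upd; case: eqP => [E|_]; last exact: m4.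
  have i_n : i < n by apply: leq_trans i_lt (size_lst b d ul al).
  by have [] := cell_inj dn zn i_n (leq0n _) E.
Qed.

Lemma mem_ok_push vis l mm z b d :
  ev_ok (rcons l (z, b, d)) -> b < n -> d < n -> b != d ->
  mem_ok vis l mm ->
  mem_ok vis (rcons l (z, b, d))
    (upd (upd mm (cell b d 0) (size (lst l b d)).+1) (cell b d (size (lst l b d)).+1) z).
Proof.
move=> [ul al] bn dn bd [m1 m2 m3 m4].
have sz b' d' : size (lst (rcons l (z, b, d)) b' d') <= n by apply: size_lst.
(* The new entry stays within the block of [(b, d)], so [cell_inj] separates it from all other
   blocks. *)
have sz1 : (size (lst l b d)).+1 <= n by have := sz b d; rewrite lst_rcons !eqxx size_rcons.
split.
- move=> x xB; rewrite /upd !ltn_eqF ?m1 //; exact: leq_trans xB (B0_cell _ _ _).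
- move=> x xn; rewrite /upd; case: (cell x x 0 =P _) => [E|_].
    by have [] := cell_inj xn dn (leq0n _) sz1 E.
  case: (cell x x 0 =P _) => [E|_]; last exact: m2.
  have [Eb Ed _] := cell_inj xn dn (leq0n _) (leq0n _) E.
  by rewrite -Eb -Ed eqxx in bd.
- move=> b' d' bn' dn' bd'; rewrite /upd; case: eqP => [E|_].
    by have [] := cell_inj dn' dn (leq0n _) sz1 E.
  rewrite lst_rcons /=; case: eqP => [E|ne].
    have [-> -> _] := cell_inj dn' dn (leq0n _) (leq0n _) E.
    by rewrite !eqxx size_rcons.
  case: ifP => [/andP[/eqP E1 /eqP E2]|_]; last exact: m3.
  by case: ne; rewrite E1 E2.
move=> b' d' i bn' dn' bd' i_lt.
have i_n := leq_trans i_lt (sz b' d'); rewrite /upd.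
case: eqP => [E|ne].
  have [-> -> [->]] := cell_inj dn' dn i_n sz1 E.
  by rewrite lst_rcons !eqxx /= nth_rcons ltnn eqxx.
case: eqP => [E|_]; first by have [] := cell_inj dn' dn i_n (leq0n _) E.
move: i_lt; rewrite lst_rcons /=; case: ifP => [/andP[/eqP E1 /eqP E2]|_]; last exact: m4.
rewrite -E1 -E2 in ne *.
rewrite size_rcons nth_rcons ltnS leq_eqVlt => /orP[/eqP Ei|i_lt].
  by case: ne; rewrite Ei.
by rewrite i_lt; apply: m4.
Qed.

(** Each intermediate value is at most the final address, which is below [M]. *)
Lemma cellE b d : b < n -> d < n ->
  (((b * S) %% M + d) %% M * S %% M + B0) %% M = cell b d 0.
Proof.
move=> bn dn; have := cell_lt bn dn (leq0n n).
rewrite /cell addn0 => lt.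
have h1 : b * S <= b * S + d by apply: leq_addr.
have h2 : b * S + d <= (b * S + d) * S by apply: leq_pmulr.
have h3 : (b * S + d) * S <= (b * S + d) * S + B0 by apply: leq_addr.
rewrite (modn_small (leq_ltn_trans (leq_trans h1 (leq_trans h2 h3)) lt)).
rewrite (modn_small (leq_ltn_trans (leq_trans h2 h3) lt)).
by rewrite (modn_small (leq_ltn_trans h3 lt)) modn_small.
Qed.

Lemma kofE mm x : (forall a, a < B0 -> mm a = mem0 a) -> x < n ->
  kof M mm 1 S x = key x.
Proof.
move=> mmE xn; have x2 : x.+2 < B0 by lia.
have x1 : x.+1 < B0 by apply: ltnW.
rewrite /kof (addn1 x) (modn_small (addr_lt (ltnW x1))) addn1 (modn_small (addr_lt (ltnW x2))).
rewrite !mmE // !input_start //; last exact: ltnW.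
rewrite (st_succ xn) addKn; have := key_lt xn; rewrite /key => lt.
by rewrite (modn_small (leq_ltn_trans (leq_addr _ _) lt)) modn_small.
Qed.

Definition glob (r : nat -> nat) := [/\ r 0 = 0, r 1 = 1, r 2 = S & r 3 = B0].

Definition zinv (r : nat -> nat) z :=
  [/\ glob r, r 5 = z, r 6 = st z, r 7 = st z.+1 & r 8 = key z].

Lemma zinv_agree r r' z : agree 9 r r' -> zinv r z -> zinv r' z.
Proof. by move=> ag [[? ? ? ?] ? ? ? ?]; split; first split; rewrite ag. Qed.

Definition ev z b ds : seq event := [seq (z, b, d) | d <- ds & key d < key b].

(** The output loop is charged to the quadruples it emits, 9 steps each; the rest is at most 40
    steps per entry of [ds], plus 2 for the exit test. *)
Lemma loop_d vis z b ds l r mm o :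
  zinv r z -> r 10 = b -> r 11 = key b -> z < n -> b < n ->
  all (fun x => x < n) ds -> r 12 + size ds = r 7 ->
  (forall i, i < size ds -> mem0 (r 12 + i) = nth 0 ds i) ->
  mem_ok vis l mm -> ev_ok (l ++ ev z b ds) ->
  exists k r' mm', [/\
    steps M P k (State 39 r mm o) =
      Some (State 25 r' mm' (o ++ flatten (map words (outs l (ev z b ds))))),
    agree 12 r r', mem_ok vis (l ++ ev z b ds) mm' &
    k <= 40 * size ds + 2 + 9 * size (outs l (ev z b ds))].
Proof.
move=> zr r10 r11 zn bn; elim: ds l r mm o zr r10 r11 => [|d ds IH] l r mm o zr r10 r11.
  move=> _ r12 _ mok eok; exists 2, (upd r 18 (r 7 - r 12)), mm.
  have -> : ev z b [::] = [::] by [].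
  rewrite !cats0; split=> //; last by solve_agree.
  by rewrite test_d -r12 addn0 subnn.
move=> /= /andP[dn dsn] r12 memE mok eok.
have [glr r5 r6 r7 r8] := zr; have [r0 r1 r2 r3] := glr.
have [mm0 _ mm1 mm2] := mok.
have rB : r 7 <= B0 by rewrite r7 st_leB0.
have E0 : steps M P 2 (State 39 r mm o) = Some (State 41 (upd r 18 (r 7 - r 12)) mm o).
  by rewrite test_d -{1}r12 addKn.
have md : mm (r 12) = d.
  by rewrite mm0; [have := memE 0 isT; rewrite addn0 | lia].
have [r' [E1 ag1 r'12 r'13 r'18]] := block_d M (upd r 18 (r 7 - r 12)) mm o.
have {}r'12 : r' 12 = (r 12).+1.
  by rewrite r'12 -[LHS]/((r 12 + r 1) %% M) r1 addn1 modn_small // addr_lt //; lia.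
have {}r'13 : r' 13 = d by rewrite r'13.
have {}r'18 : r' 18 = key b - key d.
  rewrite r'18 -[LHS]/(r 11 - kof M mm (r 1) (r 2) (mm (r 12))).
  by rewrite md r1 r2 kofE // r11.
have {}ag1 : agree 12 r r' by apply: agree_trans ag1 => //; solve_agree.
have E2 := steps_cat E0 E1 => {E0 E1}.
have memE' i : i < size ds -> mem0 ((r 12).+1 + i) = nth 0 ds i.
  by move=> i_lt; rewrite addSnnS memE.
have [kdb|kdb] := ltnP (key d) (key b); last first.
  have evE : ev z b (d :: ds) = ev z b ds by rewrite /ev /= ltnNge kdb.
  have E3 : steps M P (2 + 10 + 1) (State 39 r mm o) = Some (State 39 r' mm o).
    apply: steps_cat E2 _; rewrite branch_d r'18.
    by have /eqP -> : key b - key d == 0 by rewrite subn_eq0.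
  rewrite evE in eok *.
  have [||||||||k [r'' [mm' [E4 ag2 mok' kle]]]] := IH l r' mm o; rewrite ?r'12 ?ag1 //.
  - exact: zinv_agree (agree_trans (isT : 9 <= 12) (fun _ _ => erefl) ag1) zr.
  - by rewrite addSnnS.
  exists (2 + 10 + 1 + k), r'', mm'; split=> //; first exact: steps_cat E3 E4.
  - exact: agree_trans ag1 ag2.
  - lia.
have evE : ev z b (d :: ds) = (z, b, d) :: ev z b ds by rewrite /ev /= kdb.
rewrite evE in eok *.
(* The key test excludes [b = d], so the push never touches a diagonal mark. *)
have bd : b != d by apply: contraTneq kdb => ->; rewrite ltnn.
have E3 : steps M P (2 + 10 + 1) (State 39 r mm o) = Some (State 52 r' mm o).
  apply: steps_cat E2 _; rewrite branch_d r'18.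
  by have /negPf -> : key b - key d != 0 by rewrite subn_eq0 -ltnNge.
have [r3' [E4 ag3 r315 r316 r317]] := block_cell M r' mm o.
rewrite (ag1 10) // (ag1 2) // (ag1 3) // r10 r2 r3 r'13 cellE // in r315 r316 r317.
rewrite mm1 // in r316; rewrite mm1 // (ag1 0) // r0 in r317.
have eok1 : ev_ok (rcons l (z, b, d)).
  by move: eok; rewrite -cat_rcons; apply: ev_ok_catl.
have szl : (size (lst l b d)).+1 <= n.
  have := size_lst b d eok1.1 eok1.2.
  by rewrite lst_rcons !eqxx size_rcons.
have {}r317 : r3' 17 = size (lst l b d).
  rewrite r317 addn0 modn_small //; apply: leq_ltn_trans (cell_lt bn dn szl).
  by rewrite /cell; lia.
have ag13 : agree 12 r r3' by apply: agree_trans ag1 (agree_trans _ (fun _ _ => erefl) ag3).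
set L := lst l b d in szl r316 r317 *.
have addrE i : i <= size L -> cell b d 0 + i.+1 = cell b d i.+1 by rewrite /cell addn0.
have lt3 : r3' 15 + size L < M.
  by rewrite r315; apply: leq_ltn_trans (cell_lt bn dn szl); rewrite /cell; lia.
have r31 : r3' 1 = 1 by rewrite ag13.
have [r4' E5 ag4] := run_out mm o r31 r317 lt3.
have outE : flatten [seq [:: r3' 10; r3' 5; r3' 13; w]
      | w <- rev [seq mm (r3' 15 + i.+1) | i <- iota 0 (size L)]] =
    flatten (map words (newq l (z, b, d))).
  rewrite ag13 // (ag3 13) // ag13 // r10 r5 r'13 r315 /newq -map_comp /=.
  have -> // : [seq mm (cell b d 0 + i.+1) | i <- iota 0 (size L)] = L.
  rewrite -[RHS](mkseq_nth 0); apply/eq_in_map => i; rewrite mem_iota => /andP[_ i_lt].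
  by rewrite addrE ?mm2 // ltnW.
have [r5' [E6 ag5]] := block_push M r4' mm
  (o ++ flatten (map words (newq l (z, b, d)))).
have ag15 : agree 12 r r5'.
  by apply: agree_trans (agree_trans _ ag13 ag4) ag5.
have r5'12 : r5' 12 = (r 12).+1 by rewrite ag5 // ag4 // ag3.
have small : (size L).+1 < M.
  by apply: leq_ltn_trans (cell_lt bn dn szl); rewrite /cell; lia.
rewrite (ag4 16) // r316 (ag4 1) // r31 addn1 (modn_small small) in E6.
rewrite (ag4 15) // r315 addrE // (modn_small (cell_lt bn dn szl)) in E6.
rewrite (ag4 5) // ag13 // r5 in E6.
have mok5 := mem_ok_push eok1 bn dn bd mok.
set mm5 := upd _ _ _ in E6; rewrite -/L -/mm5 in mok5.
have [||||||||k [r'' [mm' [E7 ag6 mok' kle]]]] := IH (rcons l (z, b, d)) r5' mm5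
  (o ++ flatten (map words (newq l (z, b, d)))); rewrite ?r5'12 ?ag15 //.
- exact: zinv_agree (agree_trans (isT : 9 <= 12) (fun _ _ => erefl) ag15) zr.
- by rewrite addSnnS.
- by rewrite cat_rcons.
rewrite outE in E5.
exists (2 + 10 + 1 + 6 + (9 * size L + 1) + 5 + k), r'', mm'; split.
- rewrite (steps_cat (steps_cat (steps_cat (steps_cat E3 E4) E5) E6) E7).
  by rewrite /= map_cat flatten_cat catA.
- exact: agree_trans ag15 ag6.
- by rewrite -cat_rcons.
- rewrite /= size_cat /newq size_map size_rev -/L; lia.
Qed.

Lemma all_nb z : z < n -> all (fun x => x < n) (nb z).
Proof. by move=> zn; have [] := wf zn. Qed.

Definition evb z bs : seq event := flatten [seq ev z b (nb z) | b <- bs & key z < key b].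

(** Reaching the loop over [d] takes 14 steps, a rejected [b] only 13; the 3 covers the exit of that
    loop. *)
Definition costb z bs :=
  \sum_(b <- bs) (14 + (key z < key b) * (40 * size (nb z) + 3)).

Lemma loop_b vis z bs l r mm o :
  zinv r z -> z < n -> all (fun x => x < n) bs -> r 9 + size bs = r 7 ->
  (forall i, i < size bs -> mem0 (r 9 + i) = nth 0 bs i) ->
  mem_ok vis l mm -> ev_ok (l ++ evb z bs) ->
  exists k r' mm', [/\
    steps M P k (State 25 r mm o) =
      Some (State 5 r' mm' (o ++ flatten (map words (outs l (evb z bs))))),
    agree 9 r r', mem_ok vis (l ++ evb z bs) mm' &
    k <= costb z bs + 2 + 9 * size (outs l (evb z bs))].
Proof.
move=> zr zn; elim: bs l r mm o zr => [|b bs IH] l r mm o zr.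
  move=> _ r9 _ mok eok; exists 2, (upd r 18 (r 7 - r 9)), mm.
  have -> : evb z [::] = [::] by [].
  rewrite !cats0; split=> //; [|by solve_agree|by rewrite addn0 leq_addl].
  by rewrite test_b -r9 addn0 subnn.
move=> /= /andP[bn bsn] r9 memE mok eok.
have [glr r5 r6 r7 r8] := zr; have [r0 r1 r2 r3] := glr.
have [mm0 _ _ _] := mok.
have rB : r 7 <= B0 by rewrite r7 st_leB0.
have E0 : steps M P 2 (State 25 r mm o) = Some (State 27 (upd r 18 (r 7 - r 9)) mm o).
  by rewrite test_b -{1}r9 addKn.
have mb : mm (r 9) = b.
  by rewrite mm0; [have := memE 0 isT; rewrite addn0 | lia].
have [r' [E1 ag1 r'9 r'10 [r'11 r'18]]] := block_b M (upd r 18 (r 7 - r 9)) mm o.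
have {}r'9 : r' 9 = (r 9).+1.
  by rewrite r'9 -[LHS]/((r 9 + r 1) %% M) r1 addn1 modn_small // addr_lt //; lia.
have {}r'10 : r' 10 = b by rewrite r'10.
have {}r'11 : r' 11 = key b.
  by rewrite r'11 -[LHS]/(kof M mm (r 1) (r 2) (mm (r 9))) mb r1 r2 kofE.
have {}r'18 : r' 18 = key b - key z.
  rewrite r'18 -[LHS]/(kof M mm (r 1) (r 2) (mm (r 9)) - r 8).
  by rewrite mb r1 r2 kofE // r8.
have {}ag1 : agree 9 r r' by apply: agree_trans ag1 => //; solve_agree.
have zr' := zinv_agree ag1 zr.
have E2 := steps_cat E0 E1 => {E0 E1}.
have memE' i : i < size bs -> mem0 ((r 9).+1 + i) = nth 0 bs i.
  by move=> i_lt; rewrite addSnnS memE.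
have costE : costb z (b :: bs) =
    14 + (key z < key b) * (40 * size (nb z) + 3) + costb z bs.
  by rewrite /costb big_cons.
have [kzb|kzb] := ltnP (key z) (key b); last first.
  have evE : evb z (b :: bs) = evb z bs by rewrite /evb /= ltnNge kzb.
  have E3 : steps M P (2 + 10 + 1) (State 25 r mm o) = Some (State 25 r' mm o).
    apply: steps_cat E2 _; rewrite branch_b r'18.
    by have /eqP -> : key b - key z == 0 by rewrite subn_eq0.
  rewrite evE in eok *.
  have [|||||k [r'' [mm' [E4 ag2 mok' kle]]]] := IH l r' mm o zr';
    rewrite ?r'9 ?ag1 //.
    by rewrite addSnnS.
  exists (2 + 10 + 1 + k), r'', mm'; split=> //; first exact: steps_cat E3 E4.
  - exact: agree_trans ag1 ag2.
  - rewrite costE; lia.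
have evE : evb z (b :: bs) = ev z b (nb z) ++ evb z bs by rewrite /evb /= kzb.
rewrite evE in eok *.
have E3 : steps M P (2 + 10 + 1) (State 25 r mm o) = Some (State 38 r' mm o).
  apply: steps_cat E2 _; rewrite branch_b r'18.
  by have /negPf -> : key b - key z != 0 by rewrite subn_eq0 -ltnNge.
have E4 := steps_cat E3 (step38 M r' mm o).
have r12 : (r' 6 + r' 0) %% M = st z.
  by rewrite !ag1 // r6 r0 addn0 modn_small // addr_lt // st_leB0.
rewrite r12 in E4; set r3' := upd r' 12 (st z) in E4.
have ag3 : agree 9 r' r3' by rewrite /r3'; solve_agree.
have zr3 := zinv_agree ag3 zr'.
have eok1 : ev_ok (l ++ ev z b (nb z)) by move: eok; rewrite catA; apply: ev_ok_catl.
have r312 : r3' 12 = st z by [].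
have r37 : r3' 12 + size (nb z) = r3' 7 by rewrite r312 -st_succ //; case: zr3.
have r3mem i : i < size (nb z) -> mem0 (r3' 12 + i) = nth 0 (nb z) i.
  by move=> i_lt; rewrite r312 input_nbrs.
have [k1 [r4' [mm4 [E5 ag4 mok4 k1le]]]] :=
  loop_d o zr3 r'10 r'11 zn bn (all_nb zn) r37 r3mem mok eok1.
have ag34 : agree 9 r' r4'.
  exact: agree_trans ag3 ag4.
have r4'9 : r4' 9 = (r 9).+1 by rewrite ag4.
have ag04 := agree_trans (leqnn 9) ag1 ag34.
have [||||||k2 [r'' [mm' [E6 ag5 mok5 k2le]]]] := IH (l ++ ev z b (nb z)) r4' mm4
  (o ++ flatten (map words (outs l (ev z b (nb z))))); rewrite ?r4'9 ?ag04 //.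
- exact: zinv_agree ag04 zr.
- by rewrite addSnnS.
- by rewrite -catA.
exists (2 + 10 + 1 + 1 + k1 + k2), r'', mm'; split.
- rewrite (steps_cat (steps_cat E4 E5) E6).
  by rewrite outs_cat map_cat flatten_cat catA.
- exact: agree_trans ag04 ag5.
- by rewrite catA.
- rewrite costE kzb outs_cat size_cat; lia.
Qed.

Definition trace vs : seq event := flatten [seq evb z (nb z) | z <- vs].

(** An entry met before costs 11 steps. A first meeting costs at most 12 more, plus the scan of its
    neighbours. *)
Lemma loop_z vis ds l r mm o :
  glob r -> all (fun x => x < n) ds -> r 4 + size ds = B0 ->
  (forall i, i < size ds -> mem0 (r 4 + i) = nth 0 ds i) ->
  mem_ok vis l mm -> ev_ok (l ++ trace (visit vis ds)) ->
  exists k r' mm', 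
    steps M P k (State 5 r mm o) =
      Some (State 72 r' mm' (o ++ flatten (map words (outs l (trace (visit vis ds)))))) /\
    k <= 11 * size ds + \sum_(z <- visit vis ds) (12 + costb z (nb z)) + 2
         + 9 * size (outs l (trace (visit vis ds))).
Proof.
elim: ds vis l r mm o => [|z ds IH] vis l r mm o glr.
  move=> _ r4 _ mok eok; exists 2, (upd r 18 (r 3 - r 4)), mm.
  rewrite cats0; split; last by rewrite addn0 leq_addl.
  by case: glr => _ _ _ r3; rewrite test_z r3 -r4 addn0 subnn.
move=> /= /andP[zn dsn] r4 memE mok eok.
have [r0 r1 r2 r3] := glr; have [mm0 mmv _ _] := mok.
have E0 : steps M P 2 (State 5 r mm o) = Some (State 7 (upd r 18 (r 3 - r 4)) mm o).
  by rewrite test_z r3 -{1}r4 addKn.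
have r4_lt : r 4 < B0 by rewrite -r4 addnS ltnS leq_addr.
have mz : mm (r 4) = z by rewrite mm0 //; have := memE 0 isT; rewrite addn0.
have [r' [E1 ag1 r'4 r'5 [r'18 r'19]]] := block_z M (upd r 18 (r 3 - r 4)) mm o.
have {}r'4 : r' 4 = (r 4).+1.
  by rewrite r'4 -[LHS]/((r 4 + r 1) %% M) r1 addn1 (modn_small (addr_lt r4_lt)).
have {}r'5 : r' 5 = z by rewrite r'5.
have {}r'18 : r' 18 = cell z z 0.
  rewrite r'18 -[LHS]/((((mm (r 4) * r 2) %% M + mm (r 4)) %% M * r 2 %% M + r 3) %% M).
  by rewrite mz r2 r3 cellE.
have {}r'19 : r' 19 = mm (cell z z 0).
  rewrite r'19 -[LHS]/(mm ((((mm (r 4) * r 2) %% M + mm (r 4)) %% M * r 2 %% M + r 3) %% M)).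
  by rewrite mz r2 r3 cellE.
have {}ag1 : agree 4 r r' by apply: agree_trans ag1 => //; solve_agree.
have gl' : glob r' by split; rewrite ag1.
have memE' i : i < size ds -> mem0 ((r 4).+1 + i) = nth 0 ds i.
  by move=> i_lt; rewrite addSnnS memE.
have E2 := steps_cat (steps_cat E0 E1) (branch_z M r' mm o) => {E0 E1}.
rewrite r'19 mmv // in E2.
case: (boolP (z \in vis)) E2 eok => zv E2 eok.
  have r'4s : r' 4 + size ds = B0 by rewrite r'4 addSnnS.
  have r'mem i : i < size ds -> mem0 (r' 4 + i) = nth 0 ds i.
    by move=> i_lt; rewrite r'4 memE'.
  have [k [r'' [mm' [E3 kle]]]] := IH vis l r' mm o gl' dsn r'4s r'mem mok eok.
  exists (2 + 7 + 1 + 1 + k), r'', mm'; split; last by lia.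
  by apply: steps_cat E3; apply: steps_cat (step15 _ _ _ _).
have [r3' [E3 ag3 r36 r37 [r38 r39]]] := block_mark M r' mm o.
have eok' : ev_ok l by apply: ev_ok_catl eok.
have mok3 := mem_ok_mark eok' zn mok.
rewrite !r'5 !r'18 !(ag1 0) // !(ag1 1) // !(ag1 2) // r0 r1 r2 in E3 r36 r37 r38 r39.
set mm3 := upd mm _ _ in mok3 E3 r36 r37 r38 r39.
have [mm30 _ _ _] := mok3.
have z2B : z.+2 < B0 by rewrite !addSn !ltnS (leq_trans zn) // leq_addr.
have z1B : z.+1 < B0 := ltnW z2B.
have z1 : z + 1 < M by rewrite addn1 addr_lt // ltnW.
have z2 : z.+1 + 1 < M by rewrite addn1 addr_lt // ltnW.
have e1 : mm3 z.+1 = st z by rewrite mm30 // input_start // ltnW.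
have e2 : mm3 z.+2 = st z.+1 by rewrite mm30 // input_start.
rewrite (modn_small z1) addn1 in r36 r37 r39; rewrite (modn_small z2) addn1 in r37.
rewrite e1 in r36 r39; rewrite e2 in r37.
rewrite kofE // in r38.
rewrite addn0 modn_small ?addr_lt ?st_leB0 // in r39.
have zr3 : zinv r3' z by split=> //; first split; rewrite ag3 // ag1.
have eok1 : ev_ok (l ++ evb z (nb z)).
  by move: eok; rewrite /trace /= catA; apply: ev_ok_catl.
have r3z : r3' 9 + size (nb z) = r3' 7 by rewrite r39 r37 st_succ.
have r3mem i : i < size (nb z) -> mem0 (r3' 9 + i) = nth 0 (nb z) i.
  by move=> i_lt; rewrite r39 input_nbrs.
have [k1 [r4' [mm4 [E4 ag4 mok4 k1le]]]] :=
  loop_b o zr3 zn (all_nb zn) r3z r3mem mok3 eok1.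
have gl4 : glob r4' by split; rewrite ag4 // ag3 // ag1.
have r4'4 : r4' 4 = (r 4).+1 by rewrite ag4 // ag3.
have r4'4s : r4' 4 + size ds = B0 by rewrite r4'4 addSnnS.
have r4'mem i : i < size ds -> mem0 (r4' 4 + i) = nth 0 ds i.
  by move=> i_lt; rewrite r4'4 memE'.
have eok2 : ev_ok ((l ++ evb z (nb z)) ++ trace (visit (z :: vis) ds)).
  by move: eok; rewrite /trace /= catA.
have [k2 [r'' [mm' [E5 k2le]]]] := IH (z :: vis) (l ++ evb z (nb z)) r4' mm4
  (o ++ flatten (map words (outs l (evb z (nb z))))) gl4 dsn r4'4s r4'mem mok4 eok2.
exists (2 + 7 + 1 + 9 + k1 + k2), r'', mm'; split.
  rewrite (steps_cat (steps_cat (steps_cat E2 E3) E4) E5).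
  by rewrite /trace /= outs_cat map_cat flatten_cat catA.
rewrite big_cons /trace /= outs_cat size_cat -/(trace _); lia.
Qed.

End Ram.

(** * Correctness and running time *)

Lemma sum_uniq_seq n (t : seq nat) (F : nat -> nat) :
  uniq t -> all (fun x => x < n) t ->
  \sum_(x <- t) F x = \sum_(i < n) (nat_of_ord i \in t) * F i.
Proof.
move=> ut /allP tn.
have pe : perm_eq t [seq x <- iota 0 n | x \in t].
  apply: uniq_perm; rewrite ?filter_uniq ?iota_uniq // => x.
  by rewrite mem_filter mem_iota /=; case xt: (x \in t); rewrite //= tn.
rewrite (perm_big _ pe) big_filter -{1}(subn0 n) -/(index_iota 0 n) big_mkord big_mkcond.
by apply: eq_bigr => i _; case: (_ \in t); rewrite ?mul1n ?mul0n.
Qed.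

Section Correct.
Variable adj : seq (seq nat).
Hypothesis wf : wf_adj adj.

Local Notation n := (size adj).
Local Notation s := (sumn (map size adj)).
Local Notation nb := (nbrs adj).
Local Notation key := (key adj).
Local Notation G := (@gedge adj).

Definition tr := trace adj (visit [::] (flatten adj)).

Lemma nb_sym u v : u < n -> v \in nb u -> (v < n) && (u \in nb v).
Proof. by move=> un vu; have [_ /allP/(_ v vu) -> _ ->] := wf un. Qed.

Lemma flat_lt : all (fun x => x < n) (flatten adj).
Proof.
apply/allP => x /flattenP[t /(nthP [::])[u un <-] xt].
by case/andP: (nb_sym un xt).
Qed.

Lemma mem_flat u v : u < n -> v \in nb u -> u \in flatten adj.
Proof.
move=> un /(nb_sym un)/andP[vn uv]; apply/flattenP; exists (nb v) => //.
exact: mem_nth.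
Qed.

Lemma mem_ev z b ds z' b' d :
  ((z, b, d) \in ev adj z' b' ds) = [&& z == z', b == b', d \in ds & key d < key b'].
Proof.
apply/mapP/and4P => [[x]|[/eqP -> /eqP -> dds kd]].
  by rewrite mem_filter => /andP[kx xds] [-> -> ->].
by exists d; rewrite // mem_filter kd.
Qed.

Lemma mem_evb z b d z' bs : ((z, b, d) \in evb adj z' bs) =
  [&& z == z', b \in bs, d \in nb z', key z' < key b & key d < key b].
Proof.
apply/flatten_mapP/and5P => [[b']|[/eqP -> bbs dz kz kd]].
  by rewrite mem_filter mem_ev => /andP[kb bbs] /and4P[/eqP -> /eqP -> -> ->].
by exists b; rewrite ?mem_filter ?mem_ev ?kz // !eqxx dz kd.
Qed.

(** No vertex with an event is missed: if [b] is a neighbour of [z], then [z] occurs in the list of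
    [b], hence in [flatten adj]. *)
Lemma mem_tr z b d : ((z, b, d) \in tr) =
  [&& z < n, b \in nb z, d \in nb z, key z < key b & key d < key b].
Proof.
apply/flatten_mapP/and5P => [[z']|[zn bz dz kz kd]].
  rewrite mem_visit mem_evb => /andP[/(allP flat_lt) zn _].
  by case/and5P => /eqP -> bz dz kz kd.
exists z; last by rewrite mem_evb eqxx bz dz kz.
by rewrite mem_visit (mem_flat zn bz).
Qed.

Lemma ev_ok_tr : ev_ok adj tr.
Proof.
have nbu z : z < n -> uniq (nb z) by move=> zn; have [] := wf zn.
split; last by apply/allP => -[[z b] d]; rewrite mem_tr => /andP[].
rewrite /tr /trace; apply: (@uniq_flatten_proj _ _ (fun e : event => e.1.1)).
- exact: uniq_visit.
- move=> z; rewrite mem_visit => /andP[/(allP flat_lt)/nbu uz _].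
  apply: (@uniq_flatten_proj _ _ (fun e : event => e.1.2)).
  + by rewrite filter_uniq.
  + by move=> b _; rewrite map_inj_uniq ?filter_uniq // => x y [].
  + by move=> b [[z' b'] d]; rewrite mem_ev => /and4P[_ /eqP].
- by move=> z [[z' b] d]; rewrite mem_evb => /andP[/eqP].
Qed.

Lemma ram_halts : exists k,
  halts_in (word_mod 3 adj) c4prog (init_state adj) k
    (flatten (map words (outs [::] tr))) /\
  k <= 11 * s + \sum_(z <- visit [::] (flatten adj)) (12 + costb adj z (nb z)) + 7 +
       9 * size (outs [::] tr).
Proof.
have ltM := @word_mod_gt adj.
move: (word_mod 3 adj) ltM => M ltM.
have [r [E1 [r0 r1 r2] r3 r4]] := block_init M (mem0 adj).
have M1 : 1 < M by apply: ltM; rewrite addn3; lia.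
have n1 : n + 1 < M by apply: (addr_lt ltM); lia.
have n2 : n.+1 + 1 < M by apply: (addr_lt ltM); lia.
have mn : mem0 adj 0 = n by [].
rewrite mn (modn_small M1) (modn_small n1) addn1 in r1 r2 r3 r4.
rewrite (modn_small n2) addn1 in r4.
have gl : glob adj r.
  by split=> //; rewrite r3 input_start // st_size.
have r4s : r 4 + size (flatten adj) = n.+2 + s by rewrite r4 size_flat.
have rmem i : i < size (flatten adj) -> mem0 adj (r 4 + i) = nth 0 (flatten adj) i.
  by rewrite r4 input_flat.
(* Memory past the input is zero, which already encodes empty lists and absent marks: no
   initialisation is paid for. *)
have zero x : n.+2 + s <= x -> mem0 adj x = 0.
  move=> xB; rewrite /mem0 [LHS]nth_default //= size_cat size_map size_iota size_flat.
  by rewrite -addSn.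
have mok : mem_ok adj [::] [::] (mem0 adj).
  by split=> // *; rewrite zero // B0_cell.
have [k [r' [mm' [E2 kle]]]] :=
  loop_z wf ltM [::] gl flat_lt r4s rmem mok ev_ok_tr.
exists (5 + k); split; last first.
  by move: kle; rewrite size_flat -/tr; lia.
exists (State 72 r' mm' (flatten (map words (outs [::] tr)))); split=> //.
exact: (steps_cat E1 E2).
Qed.

Lemma key_inj x y : x < n -> y < n -> key x = key y -> x = y.
Proof.
move=> xn yn E; have := congr1 (modn^~ n.+1) E.
by rewrite /= /key !modnMDl !modn_small // ltnW.
Qed.

Lemma tr_lt z b d : (z, b, d) \in tr -> [/\ z < n, b < n & d < n].
Proof.
by rewrite mem_tr => /and5P[zn /(nb_sym zn)/andP[-> _] /(nb_sym zn)/andP[-> _] _ _].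
Qed.

Definition qval (q : quad n) : quadn :=
  (nat_of_ord q.1.1.1, nat_of_ord q.1.1.2, nat_of_ord q.1.2, nat_of_ord q.2).

Lemma lift_quads (Q : seq quadn) :
  all (fun q : quadn => [&& q.1.1.1 < n, q.1.1.2 < n, q.1.2 < n & q.2 < n]) Q ->
  exists qs, Q = map qval qs.
Proof.
elim: Q => [|[[[a b] c] d] Q IH] /=; first by exists [::].
case/andP => /and4P[an bn cn dn] /IH[qs ->].
by exists ((Ordinal an, Ordinal bn, Ordinal cn, Ordinal dn) :: qs).
Qed.

Lemma gedge_sym : symmetric G.
Proof. by move=> u v; apply/idP/idP => /(nb_sym (ltn_ord _))/andP[]. Qed.

Lemma gedge_irr : irreflexive G.
Proof. by move=> u; have [_ _ /negbTE] := wf (ltn_ord u). Qed.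

Definition topq (q : quad n) :=
  [&& key q.1.1.2 < key q.1.1.1, key q.1.2 < key q.1.1.1 & key q.2 < key q.1.1.1].

Lemma q_edges_rot m (a b c d : 'I_m) : q_edges (a, b, c, d) = q_edges (b, c, d, a).
Proof.
apply/setP => x; rewrite !inE /=.
by case: (x == _); case: (x == _); case: (x == _); case: (x == _).
Qed.

Lemma q_edges_flip m (a b c d : 'I_m) : q_edges (a, b, c, d) = q_edges (a, d, c, b).
Proof.
apply/setP => x; rewrite !inE /= [[set d; a]]setUC [[set c; d]]setUC
   [[set b; c]]setUC [[set a; b]]setUC.
by case: (x == _); case: (x == _); case: (x == _); case: (x == _).
Qed.

Lemma q_ok_rot a b c d : q_ok G (a, b, c, d) = q_ok G (b, c, d, a).
Proof.
rewrite /q_ok /is_c4 -(rot_uniq 1) /rot /=; congr (_ && _).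
by case: (G a b); case: (G b c); case: (G c d); case: (G d a).
Qed.

(** The keys of the four vertices are distinct, so exactly one rotation starts at the largest. *)
Lemma c4_top q : q_ok G q ->
  exists q', [/\ q_ok G q', topq q' & q_edges q' = q_edges q].
Proof.
have key_neq (x y : 'I_n) : x != y -> key x != key y.
  by apply: contra_neq => /key_inj E; apply: val_inj; exact: E.
case: q => [[[a b] c] d] ok.
have ok1 := ok; rewrite q_ok_rot in ok1.
have ok2 := ok1; rewrite q_ok_rot in ok2.
have ok3 := ok2; rewrite q_ok_rot in ok3.
have E1 := q_edges_rot a b c d; have E2 := q_edges_rot b c d a.
have E3 := q_edges_rot c d a b.
have /and5P[] := ok; rewrite /= !inE !negb_or !andbT -!andbA.
move=> /and4P[ab ac ad /and3P[bc bd cd]] _ _ _ _.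
move: (key_neq _ _ ab) (key_neq _ _ ac) (key_neq _ _ ad) => kab kac kad.
move: (key_neq _ _ bc) (key_neq _ _ bd) (key_neq _ _ cd) => kbc kbd kcd.
case Ta: (topq (a, b, c, d)); first by exists (a, b, c, d).
case Tb: (topq (b, c, d, a)); first by exists (b, c, d, a); rewrite E1.
case Tc: (topq (c, d, a, b)); first by exists (c, d, a, b); rewrite E1 E2.
case Td: (topq (d, a, b, c)); first by exists (d, a, b, c); rewrite E1 E2 E3.
exfalso; move: Ta Tb Tc Td; rewrite /topq /=.
move: kab kac kad kbc kbd kcd.
move: (key a) (key b) (key c) (key d) => x y z t; clear; lia.
Qed.

(** Of the eight labellings only two start at the top vertex; they differ by the reflection that
    swaps its two neighbours on the cycle. *)
Lemma topq_inj p q : q_ok G p -> q_ok G q -> topq p -> topq q ->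
  q_edges p = q_edges q -> q = p \/ q = (p.1.1.1, p.2, p.1.2, p.1.1.2).
Proof.
move=> /andP[up _] /andP[uq _] tp tq E.
have := c4_edges_dihedral up uq (esym E).
move: tp tq {up uq E}; case: p => [[[a b] c] d] /=; rewrite /topq !inE /=.
case/and3P => ba ca da.
case: q => [[[a' b'] c'] d'] /= /and3P[ba' ca' da'].
have lt_asym x y : key x < key y -> key y < key x -> False by move=> ? ?; lia.
do 7?[case/orP => [/eqP[? ? ? ?]|]]; last move=> /eqP[? ? ? ?]; subst; auto.
all: by [exfalso; apply: lt_asym ba _ | exfalso; apply: lt_asym ca _ | exfalso; apply: lt_asym da _].
Qed.

Lemma mem_qval (qs : seq (quad n)) (q : quad n) : (qval q \in map qval qs) = (q \in qs).
Proof.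
rewrite mem_map // => -[[[a b] c] d] [[[a' b'] c'] d'] [] ? ? ? ?.
by congr (_, _, _, _); apply: val_inj.
Qed.

Lemma tr_lists : exists qs : seq (quad n),
  [/\ outs [::] tr = map qval qs, all (q_ok G) qs,
      uniq (map (@q_edges n) qs) &
      forall S, (S \in C4 G) <-> (S \in map (@q_edges n) qs)].
Proof.
pose tri (z b d : 'I_n) : event := (nat_of_ord z, nat_of_ord b, nat_of_ord d).
have [utr _] := ev_ok_tr.
have [|qs Eqs] := @lift_quads (outs [::] tr).
  apply/allP => -[[[b z] d] w]; rewrite mem_outs // => /andP[tz iw] /=.
  have tw : (w, b, d) \in tr by rewrite -index_mem (ltn_trans iw) // index_mem.
  by have [-> -> ->] := tr_lt tz; have [-> _ _] := tr_lt tw.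
have qsE b z d w : ((b, z, d, w) \in qs) = [&& G z b, G z d, G w b, G w d,
    key z < key b, key w < key b, key d < key b &
    index (tri w b d) tr < index (tri z b d) tr].
  rewrite -mem_qval -Eqs mem_outs //.
  rewrite -/(tri z b d) -/(tri w b d).
  have -> : (tri z b d \in tr) && (index (tri w b d) tr < index (tri z b d) tr) =
    [&& tri z b d \in tr, tri w b d \in tr & index (tri w b d) tr < index (tri z b d) tr].
    apply/andP/and3P => [[tz iw]|[]//]; split=> //.
    by rewrite -index_mem (ltn_trans iw) // index_mem.
  rewrite !mem_tr !ltn_ord /=.
  rewrite -![nat_of_ord _ \in _]/(G _ _).
  case: (G z b); case: (G z d); case: (G w b); case: (G w d); rewrite ?andbF //=.
  by case: (key z < key b); case: (key w < key b); case: (key d < key b).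
have okqs q : q \in qs -> q_ok G q /\ topq q.
  case: q => [[[b z] d] w]; rewrite qsE => /and5P[zb zd wb wd /and4P[kz kw kd iw]].
  rewrite /topq /= kz kw kd; split=> //.
  rewrite /q_ok /is_c4 /= (gedge_sym b z) (gedge_sym d w) zb zd wd wb !andbT.
  have neq (x y : 'I_n) : key x < key y -> x != y.
    by apply: contraTneq => ->; rewrite ltnn.
  have neqG x y : G x y -> x != y by apply: contraTneq => ->; rewrite gedge_irr.
  rewrite !inE !negb_or (neqG _ _ zd) [b == z]eq_sym (neq _ _ kz) [b == d]eq_sym (neq _ _ kd).
  rewrite [b == w]eq_sym (neq _ _ kw) [d == w]eq_sym (neqG _ _ wd) /= andbT.
  (* [z] and [w] differ because their events have different indices. *)
  by apply: contraTneq iw => ->; rewrite ltnn.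
exists qs; split=> //.
- by apply/allP => q /okqs[].
- rewrite map_inj_in_uniq.
    by have := uniq_outs utr; rewrite Eqs => /map_uniq.
  move=> p q pq qq E.
  have [[okp tp] [okq tq]] := (okqs _ pq, okqs _ qq).
  case: (topq_inj okp okq tp tq E) => // E'.
  move: pq qq; rewrite {}E'; case: p {okp tp E} => [[[b z] d] w] /=; rewrite !qsE.
  (* The reflected labelling would require the opposite order of the two events. *)
  case/and5P => _ _ _ _ /and4P[_ _ _ lt1].
  by case/and5P => _ _ _ _ /and4P[_ _ _ /ltn_trans/(_ lt1)]; rewrite ltnn.
move=> S; split; last first.
  by case/mapP => q /okqs[okq _] ->; apply/C4P; exists q.
case/C4P => q /c4_top[[[[b z] d] w] [ok tp <-]] ->.
have /and5P[_ bz zd dw wb] := ok.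
have /and3P[/= kz kd kw] := tp.
have zw : tri z b d != tri w b d.
  have /and5P[] := ok; rewrite /= !inE !negb_or => /and4P[_ /andP[_ zw] _ _] _ _ _ _.
  by apply: contra_neq zw => -[] /val_inj.
have itr x : G b x -> G x d -> key x < key b -> tri x b d \in tr.
  move=> bx xd kx; rewrite mem_tr ltn_ord kx kd -![nat_of_ord _ \in _]/(G _ _).
  by rewrite gedge_sym bx xd.
have tz := itr z bz zd kz.
have tw : tri w b d \in tr by apply: itr; rewrite // gedge_sym.
(* Whichever of [z] and [w] is processed second reports the cycle; in the second case the labelling
   is reflected. *)
have [lt|gt|eqi] := ltngtP (index (tri w b d) tr) (index (tri z b d) tr).
- by apply: map_f; rewrite qsE gedge_sym bz zd wb gedge_sym dw kz kw kd lt.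
- rewrite q_edges_flip; apply: map_f.
  by rewrite qsE wb gedge_sym dw gedge_sym bz zd kz kw kd gt.
- by case/eqP: zw; rewrite -[LHS](nth_index (0,0,0) tz) -eqi nth_index.
Qed.

(** * Total running time *)

Definition up : rel 'I_n := fun z b => key z < key b.

Lemma sum_nb z (F : nat -> nat) : z < n ->
  \sum_(b <- nb z) F b = \sum_(b < n) (nat_of_ord b \in nb z) * F b.
Proof. by move=> zn; have [uz az _ _] := wf zn; apply: sum_uniq_seq. Qed.

Lemma deg_gedge z : deg G z = size (nb z).
Proof.
rewrite -(sum1_size (nb z)) sum_nb //; apply: eq_bigr => b _.
by rewrite muln1.
Qed.

Lemma sum_deg : \sum_z deg G z = s.
Proof.
rewrite sumnE big_map (big_nth [::]) big_mkord.
by apply: eq_bigr => z _; rewrite deg_gedge.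
Qed.

Lemma up_deg z b : G z b -> up z b -> deg G z <= deg G b.
Proof.
move=> _; rewrite /up /key !deg_gedge => lt; rewrite leqNgt; apply/negP => dbz.
move: lt; apply/negP; rewrite -leqNgt.
have bn : b < n.+1 by rewrite ltnW // ltnS.
have := leq_mul dbz (leqnn n.+1); rewrite mulSn.
by move: (size (nb b) * _) (size (nb z) * _) => x y; lia.
Qed.

Lemma cost_le :
  \sum_(z <- visit [::] (flatten adj)) (12 + costb adj z (nb z)) <=
  26 * s + 43 * work G up.
Proof.
have vlt : all (fun z => z < n) (visit [::] (flatten adj)).
  by apply/allP => z; rewrite mem_visit => /andP[/(allP flat_lt)].
have usize : size (visit [::] (flatten adj)) <= s.
  rewrite -size_flat; apply: uniq_leq_size; first exact: uniq_visit.
  by move=> z; rewrite mem_visit => /andP[].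
rewrite big_split /= big_const_seq count_predT iter_addn_0.
apply: (@leq_trans (12 * s + (14 * s + 43 * work G up))); last by lia.
apply: leq_add; first by rewrite leq_mul2l.
rewrite (sum_uniq_seq _ (uniq_visit _ _) vlt).
rewrite -sum_deg big_distrr /= /work big_distrr /= -big_split /=.
apply: leq_sum => z _; apply: (@leq_trans (costb adj z (nb z))).
  by case: (_ \in _); rewrite ?mul1n.
rewrite /costb big_split /= big_const_seq count_predT iter_addn_0 deg_gedge leq_add2l.
rewrite (sum_nb _ (ltn_ord z)) mulnA big_distrr /=; apply: leq_sum => b _.
rewrite /gedge /up; case bz: (_ \in nb z) => //=; rewrite mul1n.
case: (key z < key b); rewrite ?muln0 ?mul1n ?muln1 //.
(* As [z] has a neighbour, the additive 3 is absorbed: [40 deg + 3 <= 43 deg]. *)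
have : 0 < size (nb z) by case: (nb z) bz.
clear; lia.
Qed.

Lemma listing : exists k out,
  [/\ halts_in (word_mod 3 adj) c4prog (init_state adj) k out,
      lists_all_C4 G out &
      k <= 43 * (1 + s + work G up + #|C4 G|)].
Proof.
have [k [hk kle]] := ram_halts; have [qs [E ok uq mq]] := tr_lists.
exists k, (flatten (map words (outs [::] tr))); split=> //.
  by exists qs; split=> //; rewrite E -map_comp.
(* The outputs have distinct edge sets that exhaust [C4 G], so the output cost is linear in the
   number of 4-cycles. *)
have -> : #|C4 G| = size qs.
  rewrite -(size_map (@q_edges n)) -(card_uniqP uq); apply: eq_card => S.
  by apply/idP/idP => /mq.
have := cost_le; rewrite E size_map in kle.
move: kle; move: (\sum_(_ <- _) _) (work _ _) s (size qs) => a b c d; clear; lia.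
Qed.

Lemma sum_deg_le : s <= n ^ 2.
Proof.
rewrite -sum_deg; apply: (@leq_trans (\sum_(z < n) n)).
  by apply: leq_sum => z _; have := deg_le_card G z; rewrite card_ord.
by rewrite sum_nat_const card_ord mulnn.
Qed.

Lemma listing_dense : 1 + s + work G up + #|C4 G| <= 6 * (n ^ 2 + #|C4 G| + 1).
Proof.
have := work_le_dense gedge_sym gedge_irr (numc4q_C4 G) up.
rewrite card_ord; have := sum_deg_le.
move: (work _ _) s (n ^ 2) #|C4 G| => w x y z; clear; lia.
Qed.

(** Degrees are at most [n], so [trunc_log 2 n + 1] levels suffice; since [n > 1] this is at most
    twice the logarithm. *)
Lemma listing_sparse Y : 1 < n -> s ^ 4 <= Y ^ 3 ->
  1 + s + work G up + #|C4 G| <= 12 * trunc_log 2 n * (Y + 1 + #|C4 G|).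
Proof.
move=> n1 sY.
have /andP[_ nlt] := (trunc_log_bounds (isT : 1 < 2) (ltnW n1)).
have K1 : 0 < trunc_log 2 n by rewrite trunc_log_gt0.
have dK z : deg G z < 2 ^ (trunc_log 2 n).+1.
  by apply: leq_ltn_trans nlt; have := deg_le_card G z; rewrite card_ord.
have sY1 : (\sum_z deg G z) ^ 4 <= Y ^ 3 by rewrite sum_deg.
have := work_le_sparse gedge_sym gedge_irr (numc4q_C4 G) up_deg dK sY1.
have sleY : s <= Y.
  rewrite -(leq_exp2r _ _ (isT : 0 < 3)); apply: leq_trans sY.
  by case: (s) => // x; rewrite leq_pexp2l.
move: K1 sleY; move: (trunc_log 2 n) (work _ _) s #|C4 G| => K w x t; clear; nia.
Qed.

End Correct.

(** * Real bounds *)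

Delimit Scope R_scope with R.

Lemma INR_leq (a b : nat) : a <= b -> (INR a <= INR b)%R.
Proof. by move=> /leP; apply: le_INR. Qed.

Lemma INR_addn (a b : nat) : INR (a + b) = (INR a + INR b)%R.
Proof. by rewrite -plus_INR. Qed.

Lemma INR_muln (a b : nat) : INR (a * b) = (INR a * INR b)%R.
Proof. by rewrite -mult_INR. Qed.

Lemma INR_expn (a b : nat) : INR (a ^ b) = (INR a ^ b)%R.
Proof. by elim: b => [|b IH] //; rewrite expnS INR_muln IH. Qed.

Lemma cube_lt (x y : R) : (0 <= y -> x ^ 3 < y ^ 3 -> x < y)%R.
Proof.
move=> y0 lt; apply: Rnot_le_lt => yx; apply: (Rlt_irrefl (y ^ 3)).
by apply: Rle_lt_trans lt; apply: pow_incr.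
Qed.

(* [Rpower 0 (4 / 3) = 1], because [ln 0 = 0]; hence the [maxn]. *)
Lemma Rpower_4_3_cube m :
  (1 <= Rpower (INR m) (4 / 3) /\ Rpower (INR m) (4 / 3) ^ 3 = INR (maxn m 1) ^ 4)%R.
Proof.
have pos x y : (0 < Rpower x y)%R by apply: exp_pos.
case: m => [|m].
  have ln0 : ln 0 = 0%R.
    by rewrite /ln; case: Rlt_dec => // H; exfalso; exact: Rlt_irrefl H.
  rewrite /Rpower /= ln0 Rmult_0_r exp_0; lra.
have m1 : (1 <= INR m.+1)%R by apply: (@INR_leq 1).
split.
  rewrite -{1}(Rpower_O 1); last lra.
  apply: (@Rle_trans _ (Rpower (INR m.+1) 0)).
    by rewrite !Rpower_O; lra.
  by apply: Rle_Rpower; lra.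
have -> : maxn m.+1 1 = m.+1 by rewrite /maxn; case: m {m1}.
rewrite -Rpower_pow; last exact: pos.
rewrite Rpower_mult -(Rpower_pow 4); last lra.
by congr Rpower; rewrite !S_INR /=; field.
Qed.

(** [Y] is the least integer above [s^(4/3)]. Minimality gives [(Y - 1)^3 <= (3 max(m, 1))^4 = 81
    X^3 < (5 X)^3], and [1 <= X] turns [5 X + 1] into [6 X]. The successor in the hypothesis allows
    for the floor in [m_of]. *)
Lemma ceil_cube_root s m : s <= (2 * m).+1 ->
  exists2 Y, s ^ 4 <= Y ^ 3 & (INR Y <= 6 * Rpower (INR m) (4 / 3))%R.
Proof.
move=> sm; have [] := Rpower_4_3_cube m; move: (Rpower _ _) => X X1 X3.
have ex : exists Y, s ^ 4 <= Y ^ 3.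
  by exists (s ^ 4); case: (s ^ 4) => // x; rewrite -{1}(expn1 x.+1) leq_pexp2l.
case: (ex_minnP ex) => Y sY minY; exists Y => //.
case: Y sY minY => [|y] _ minY; first by rewrite /=; lra.
have ys : y ^ 3 <= s ^ 4.
  by rewrite ltnW // ltnNge; apply/negP => /minY; rewrite ltnn.
have s3 : s <= 3 * maxn m 1 by lia.
have : (INR y ^ 3 < (5 * X) ^ 3)%R.
  rewrite -INR_expn; apply: (@Rle_lt_trans _ (INR ((3 * maxn m 1) ^ 4))).
    by apply: INR_leq; apply: leq_trans ys _; rewrite leq_exp2r.
  rewrite INR_expn INR_muln !Rpow_mult_distr -X3 /=.
  have : (0 < X ^ 3)%R by apply: pow_lt; lra.
  rewrite /=; lra.
move/cube_lt => H; rewrite S_INR; have := H _; lra.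
Qed.

(** For the case where the logarithmic factor vanishes. *)
Lemma C4_small n (E : rel 'I_n) : n <= 1 -> #|C4 E| = 0.
Proof.
move=> n1; apply: eq_card0 => S; apply/negP => /C4P[q /and5P[/card_uniqP uq _ _ _ _] _].
have := max_card (mem [:: q.1.1.1; q.1.1.2; q.1.2; q.2]).
by rewrite uq card_ord /= leqNgt (leq_ltn_trans n1).
Qed.

Lemma ln_le x y : (0 < x -> x <= y -> ln x <= ln y)%R.
Proof. by move=> x0 [lt|->]; [left; exact: ln_increasing | right]. Qed.

(** Since [ln 2 > 1/2], the binary logarithm is at most [2 ln n]; since [ln n > 1/2] as well, this
    is at most [4 (ln n)^2]. *)
Lemma trunc_log_le_ln n : 1 < n -> (INR (trunc_log 2 n) <= 4 * ln (INR n) ^ 2)%R.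
Proof.
move=> n1; have ln2 := ln_lt_2.
have n2 : (2 <= INR n)%R by apply: (@INR_leq 2).
have Ln : (ln 2 <= ln (INR n))%R by apply: ln_le; lra.
have : (INR (trunc_log 2 n) * ln 2 <= ln (INR n))%R.
  rewrite -ln_pow; last lra.
  apply: ln_le; first by apply: pow_lt; lra.
  rewrite -[2%R]/(INR 2) -INR_expn; apply: INR_leq.
  by apply: trunc_logP => //; exact: ltnW.
have := pos_INR (trunc_log 2 n).
move: (INR (trunc_log 2 n)) (ln (INR n)) (ln 2) Ln ln2 => K L l; nra.
Qed.

Theorem theorem1 :
  exists (P : seq instr) (k C : nat),
    forall adj : seq (seq nat), wf_adj adj ->
      exists (steps_used : nat) (out : seq nat),
        [/\ halts_in (word_mod k adj) P (init_state adj) steps_used out,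
            lists_all_C4 (@gedge adj) out &
            Rle (INR steps_used)
                (Rmult (INR C)
                   (Rplus (c4_bound (n_of adj) (m_of adj) #|C4 (@gedge adj)|) 1))].
Proof.
(* 43 comes from [listing]; [336 = 12 * 4 * 7] combines [listing_sparse], [trunc_log_le_ln] and
   [Y + 1 <= 7 X]. *)
exists c4prog, 3, (43 * 336) => adj wf.
have [k [out [hk lk kle]]] := listing wf.
exists k, out; split=> //.
have dense : k <= 43 * 6 * (size adj ^ 2 + #|C4 (@gedge adj)| + 1).
  by apply: leq_trans kle _; rewrite -mulnA leq_mul2l listing_dense.
rewrite /c4_bound /n_of; set t := #|C4 _| in kle dense *.
set X := Rpower _ _; have X1 : (1 <= X)%R := proj1 (Rpower_4_3_cube (m_of adj)).
have t0 := pos_INR t.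
have L0 : (0 <= ln (INR (size adj)) ^ 2)%R by apply: pow2_ge_0.
have CE : INR (43 * 336) = (43 * 336)%R by rewrite INR_muln !INR_IZR_INZ.
rewrite /Rmin; case: Rle_dec => _.
  have := INR_leq dense; rewrite INR_muln INR_addn CE.
  have -> : INR (43 * 6) = (43 * 6)%R by rewrite INR_muln !INR_IZR_INZ.
  have := pos_INR (size adj ^ 2 + t); move: (INR (_ + t)) => /= z; lra.
have XL0 : (0 <= (X + INR t) * ln (INR (size adj)) ^ 2)%R by apply: Rmult_le_pos; lra.
(* For [n <= 1] the logarithm is 0, and the constant time given by [dense] is absorbed by the
   additive 1 of the bound. *)
have [n1|n1] := leqP (size adj) 1.
  have : k <= 43 * 12.
    apply: leq_trans dense _; rewrite /t C4_small // addn0 -mulnA leq_mul2l /=.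
    by case: (size adj) n1 => [|[]].
  move: ((X + INR t) * _)%R XL0 => B B0.
  by move=> /INR_leq; rewrite CE INR_muln !INR_IZR_INZ /=; lra.
have sm : sumn (map size adj) <= (2 * m_of adj).+1.
  by rewrite /m_of; move: (sumn _) => s; lia.
have [Y sY YX] := ceil_cube_root sm.
have := INR_leq (leq_trans kle (leq_mul (leqnn 43) (listing_sparse wf n1 sY))).
rewrite -/t CE !INR_muln !INR_addn.
have KL := trunc_log_le_ln n1; have K0 := pos_INR (trunc_log 2 (size adj)).
have Y0 := pos_INR Y.
have -> : INR 43 = 43%R by rewrite INR_IZR_INZ.
have -> : INR 12 = 12%R by rewrite INR_IZR_INZ.
have -> : INR 1 = 1%R by [].
rewrite -/X in YX; move: (INR (trunc_log 2 _)) (ln _ ^ 2)%R (INR Y) (INR t) X KL K0 Y0 YX X1 t0 L0 XL0.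
move=> K L y u x KL K0 Y0 YX X1 t0 L0 XL0 H.
have : (K * (y + 1 + u) <= 4 * L * (7 * (x + u)))%R.
  by apply: Rmult_le_compat; lra.
lra.
Qed.
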